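(* Let $\omega=(\tilde\omega,\omega_d)\in\mathbb R^d$, $d\geq3$, be non-resonant with $\tilde\omega\in\mathbb R^{d-1}$ such that there is a sequence $\{\bar k_j\}\subset\mathbb Z^{d-1}$ with $\lim_{j\to\infty}\frac{\ln|\langle\tilde\omega,\bar k_j\rangle|}{\|\bar k_j\|}=-\infty$. There exists a real entire Hamiltonian $H$ on $\mathbb{T}^d\times\mathbb R^d$ of the form $H(\theta,r)=\langle\omega,r\rangle+\mathcal O(r^2)$ such that: (i) there exists a real analytic symplectic diffeomorphism $\Psi$ of $M^-=\mathbb{T}^d\times\mathbb R^{d-1}\times(-\infty,0)$ onto itself with $H\circ\Psi=H_0$ on $M^-$, where $H_0(\theta,r)=\langle\omega,r\rangle$; (ii) for every $(\theta,r)\in\mathbb{T}^d\times\mathbb R^{d-1}\times(0,\infty)$, $\limsup_{t\to\infty}|\Phi^t_H(\theta,r)|=\infty$. Moreover the Birkhoff normal form of $H$ at $\mathcal{T}_0=\mathbb{T}^d\times\{0\}$ is $N(r)=\langle\omega,r\rangle$.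
   Context: $\|k\|=\max_m|k_m|$; non-resonant means rationally independent coordinates. Real entire: extends holomorphically to $(\mathbb C/\mathbb Z)^d\times\mathbb C^d$, real on real arguments. $\Phi^t_H$ is the Hamiltonian flow for $d\theta\wedge dr$; $|\Phi^t_H(\theta,r)|$ refers to the size of the action component. Birkhoff normal form: formal power series $N_H(r)$ such that some formal series $f(\theta,r)=\sum_j a_j(\theta)r^j=\mathcal O(r^2)$ with coefficients real analytic near $\mathbb{T}^d$ satisfies $H(\theta,r+\partial_\theta f(\theta,r))=N_H(r)$. *)

(* Defs.v *)
From mathcomp Require Import all_boot all_order all_algebra.
From mathcomp Require Import all_classical all_reals all_analysis.
From mathcomp Require Import complex.
Import Order.TTheory GRing.Theory Num.Theory.

Set Implicit Arguments.
Unset Strict Implicit.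
Unset Printing Implicit Defensive.

Local Open Scope classical_set_scope.
Local Open Scope ring_scope.

Definition shiftv (K : zmodType) (I : eqType) (p : I -> K) (i : I) (h : K)
  : I -> K := fun j => if j == i then p j + h else p j.

Definition cplx (R : realType) (I : Type) (x : I -> R) : I -> R[i] :=
  fun j => ((x j)%:C)%C.

Definition cclose (R : realType) (I : Type) (delta : R) (p q : I -> R[i]) :=
  forall j, `|p j - q j| < (delta%:C)%C.
Definition rclose (R : realType) (I : Type) (delta : R) (p q : I -> R) :=
  forall j, `|p j - q j| < delta.

(* F is holomorphic on the (open) set U of C^I: continuous at every point
   of U and complex differentiable in each variable separately
   (Osgood's definition of holomorphy in several variables). *)
Definition holo_on (R : realType) (I : finType)
    (U : set (I -> R[i])) (F : (I -> R[i]) -> R[i]) : Prop :=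
  forall p, U p ->
    (forall eps : R, 0 < eps -> exists2 delta : R, 0 < delta &
       forall q, U q -> cclose delta p q -> `|F q - F p| < (eps%:C)%C) /\
    (forall i : I, exists L : R[i], forall eps : R, 0 < eps ->
       exists2 delta : R, 0 < delta & forall h : R[i],
         0 < `|h| -> `|h| < (delta%:C)%C -> U (shiftv p i h) ->
         `|F (shiftv p i h) - F p - L * h| <= (eps%:C)%C * `|h|).

Definition real_analytic_on (R : realType) (I : finType)
    (U : set (I -> R)) (f : (I -> R) -> R) : Prop :=
  forall p, U p -> exists2 rho : R, 0 < rho &
    exists F : (I -> R[i]) -> R[i],
      holo_on [set z | cclose rho (cplx p) z] F /\
      (forall x, U x -> rclose rho p x -> F (cplx x) = ((f x)%:C)%C).

(* Phase space T^d x R^d, lifted to R^d x R^d.  A point is a function *)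
(* on 'I_d + 'I_d: inl i is the angle theta_i, inr i the action r_i.  *)
(* Functions on T^d x R^d are 1-periodic in every theta_i.            *)

Definition ptT (R : Type) (d : nat) := ('I_d + 'I_d)%type -> R.

Definition ang (R : Type) d (p : ptT R d) : 'I_d -> R := fun i => p (inl i).
Definition act (R : Type) d (p : ptT R d) : 'I_d -> R := fun i => p (inr i).

Definition transl (K : pzRingType) d (p : ptT K d) (k : 'I_d -> int) : ptT K d :=
  fun x => match x with inl i => p (inl i) + (k i)%:~R | inr i => p (inr i) end.

Definition sameT (R : realType) d (p q : ptT R d) : Prop :=
  exists k : 'I_d -> int, q = transl p k.

Definition pairing (R : realType) d (w r : 'I_d -> R) : R :=
  \sum_(i < d) w i * r i.

(* H is a real entire Hamiltonian on T^d x R^d: it extends to a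
   holomorphic function on C^d x C^d which is Z^d-periodic in the angle
   variables (i.e. a holomorphic function on (C/Z)^d x C^d), and which is
   real on real arguments (it coincides there with H). *)
Definition real_entire_ham (R : realType) d (H : ptT R d -> R) : Prop :=
  exists F : ptT R[i] d -> R[i],
    holo_on setT F /\
    (forall z k, F (transl z k) = F z) /\
    (forall p, F (cplx p) = ((H p)%:C)%C).

Definition ham_form (R : realType) d (w : 'I_d -> R) (H : ptT R d -> R) : Prop :=
  exists2 C : R, 0 < C & exists2 delta : R, 0 < delta &
    forall p : ptT R d, (forall i, `|act p i| <= delta) ->
      `|H p - pairing w (act p)| <= C * \sum_(i < d) (act p i) ^+ 2.

Definition pder (R : realType) (I : eqType) (f : (I -> R) -> R) (p : I -> R) (x : I)
  : R := derive1 (fun s : R => f (shiftv p x s)) 0.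

Definition dmap (R : realType) d (Psi : ptT R d -> ptT R d) (p u : ptT R d)
  : ptT R d := fun y => derive1 (fun s : R => Psi (p + s *: u) y) 0.

Definition sympl (R : realType) d (u v : ptT R d) : R :=
  \sum_(i < d) (u (inl i) * v (inr i) - u (inr i) * v (inl i)).

Definition ham_sol_fwd (R : realType) d (H : ptT R d -> R) (gamma : R -> ptT R d)
  : Prop :=
  forall t : R, 0 <= t -> forall i : 'I_d,
    is_derive t 1 (fun s => gamma s (inl i)) (pder H (gamma t) (inr i)) /\
    is_derive t 1 (fun s => gamma s (inr i)) (- pder H (gamma t) (inl i)).

Definition Mneg (R : realType) d : set (ptT R d) :=
  [set p | forall i : 'I_d, val i = d.-1 -> p (inr i) < 0].
Definition Mpos (R : realType) d : set (ptT R d) :=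
  [set p | forall i : 'I_d, val i = d.-1 -> 0 < p (inr i)].
Arguments Mneg : clear implicits.
Arguments Mpos : clear implicits.

(* Psi (a lift) is a real analytic symplectic diffeomorphism of
   M^- (as a subset of T^d x R^d) onto itself, with inverse (lift) Phi *)
Definition analytic_sympl_diffeo_Mneg (R : realType) d
    (Psi Phi : ptT R d -> ptT R d) : Prop :=
  (* both descend to maps of T^d x R^d *)
  (forall p k, Mneg R d p -> sameT (Psi p) (Psi (transl p k))) /\
  (forall p k, Mneg R d p -> sameT (Phi p) (Phi (transl p k))) /\
  (forall p, Mneg R d p -> Mneg R d (Psi p)) /\
  (forall p, Mneg R d p -> Mneg R d (Phi p)) /\
  (forall p, Mneg R d p -> sameT (Phi (Psi p)) p) /\
  (forall p, Mneg R d p -> sameT (Psi (Phi p)) p) /\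
  (forall y, real_analytic_on (Mneg R d) (fun p => Psi p y)) /\
  (forall y, real_analytic_on (Mneg R d) (fun p => Phi p y)) /\
  (forall p u v, Mneg R d p -> sympl (dmap Psi p u) (dmap Psi p v) = sympl u v).

(* Birkhoff normal form.  A formal series f(theta,r) = sum_a a_a(theta) r^a *)
(* is given by its coefficients a : multi-index -> (R^d -> R).            *)

Definition mindex (d : nat) := {ffun 'I_d -> nat}.

Definition trunc_series (R : realType) d (a : mindex d -> ('I_d -> R) -> R)
    (N : nat) (th r : 'I_d -> R) : R :=
  \sum_(al : {ffun 'I_d -> 'I_N.+1} | (\sum_(i < d) al i <= N)%N)
     a [ffun i => nat_of_ord (al i)] th * \prod_(i < d) r i ^+ al i.

Definition joinpt (R : Type) d (th r : 'I_d -> R) : ptT R d :=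
  fun x => match x with inl i => th i | inr i => r i end.

(* N is a Birkhoff normal form of H at T^d x {0}: there is a formal series
   f = sum_a a_a(theta) r^a = O(r^2) with real analytic (Z^d-periodic)
   coefficients such that H(theta, r + d_theta f(theta,r)) = N(r) as formal
   power series in r.  The formal identity is expressed degree by degree:
   for every order M, substituting the degree-M truncation f_M of f gives
   H(theta, r + d_theta f_M(theta,r)) - N(r) = O(|r|^(M+1)) as r -> 0. *)
Definition is_BNF (R : realType) d (H : ptT R d -> R) (N : ('I_d -> R) -> R)
  : Prop :=
  exists a : mindex d -> ('I_d -> R) -> R,
    (forall al : mindex d, (\sum_(i < d) al i <= 1)%N -> forall th, a al th = 0) /\
    (forall al : mindex d, real_analytic_on setT (a al)) /\
    (forall (al : mindex d) th (k : 'I_d -> int),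
        a al (fun i => th i + (k i)%:~R) = a al th) /\
    (forall (M : nat) (th : 'I_d -> R),
       exists2 C : R, 0 < C & exists2 delta : R, 0 < delta &
         forall r : 'I_d -> R, (forall i, `|r i| <= delta) ->
           `|H (joinpt th (fun i => r i +
                  pder (fun th' => trunc_series a M th' r) th i))
             - N r|
           <= C * (\sum_(i < d) `|r i|) ^+ M.+1).

(* Main.v *)
Require Import Defs.
From mathcomp Require Import all_boot all_order all_algebra.
From mathcomp Require Import all_classical all_reals all_analysis.
From mathcomp Require Import complex.
From mathcomp Require Import ring lra zify.
Import Order.TTheory GRing.Theory Num.Theory.
Import numFieldNormedType.Exports.
Local Open Scope classical_set_scope.
Local Open Scope ring_scope.

Set Implicit Arguments.
Unset Strict Implicit.
Unset Printing Implicit Defensive.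

(** With s = r_d and a sparse subsequence k_j of the given frequencies (extended
    by 0 in the last coordinate), put e_j = <omega, k_j> and
      H = <omega, r> + sum_j e_j A_j(s) cos(2 pi <k_j, theta>),
      A_j(s) = s^(j+2) exp(m_j s).
    Neither theta_d nor the actions r_1, ..., r_(d-1) occur in the perturbation,
    so s is constant along orbits, theta_1, ..., theta_(d-1) move linearly, and
    everything is explicit.  The solution of the cohomological equation is
      f = - sum_j A_j(s) sin(2 pi <k_j, theta>) / (2 pi).
    The e_j are so small that H is entire although A_j grows superexponentially
    for s > 0.  For Re s < 0 the A_j decay and f generates the conjugacy
    r -> r + d_theta f, theta_d -> theta_d - d_s f.  For s > 0 the j-th mode
    moves r by about A_j(s) |k_j| within time 1 / |e_j|; it dominates the slower
    growing modes of smaller index, and the modes of larger index have not yet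
    moved by then.  Because of the factor s^(j+2) each Taylor coefficient of f
    at s = 0 is a trigonometric polynomial, so f is also a formal solution and
    the Birkhoff normal form is trivial. *)

(** * Geometrically bounded series *)

(** Three requirements pull on the same constants. [M j] is at least the sup norm of k_j and at
    least (j+1)^2, the exponent is m_j = (j+1) M_j, and |e_j| <= exp(-(j+1)^2 M_j). The weight j+1
    eventually beats every constant K, so the series converge for Re s < 0 despite factors exp(K
    M_j) from complex angles and from differentiation. The weight (j+1)^2 eventually beats S (j+1)
    for every S, so H is entire. And m_j exceeds each earlier m_l by at least M_j, so the j-th mode
    can dominate for s > 0. Such divisors exist because |e_j| falls below exp(-K ||k_j||) for every
    K. The factor e_j in H cancels the divisor in the cohomological equation, so f carries no small
    divisors. Its amplitudes blow up for s > 0, however; orbits are therefore written with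
    increments of cosines in time, which remain summable. Holomorphy is obtained without Cauchy
    theory: every term has an explicit quadratic Taylor remainder, and summing these gives complex
    differentiability, the real partial derivatives and the differential of the conjugacy at
    once. *)

Section GeometricSums.
Variable R : realType.
Implicit Types (u v : nat -> R) (D : R).

Definition rsum u : R := limn (series u).
(** A fixed ratio 1/2 makes the class closed under linear combinations and bounds the sum by twice
    the constant. *)
Definition geo u := exists D, forall j, `|u j| <= D * 2^-1 ^+ j.

Lemma half_norm_lt1 : `|2^-1 : R| < 1.
Proof. by rewrite ger0_norm ?invr_ge0 // invf_lt1 // ltr1n. Qed.

Lemma geo_norm_cvg u D : (forall j, `|u j| <= D * 2^-1 ^+ j) ->
  cvgn [normed series u].
Proof.
move=> uD; have D0 : 0 <= D by have := uD 0%N; rewrite expr0 mulr1; apply: le_trans.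
apply: (@series_le_cvg _ _ (geometric D 2^-1)); [by move=> n /= | | by [] | ].
  by move=> n /=; rewrite ?normr_ge0 // mulr_ge0 // exprn_ge0 // invr_ge0.
exact/is_cvg_geometric_series/half_norm_lt1.
Qed.

Lemma geo_cvg u : geo u -> cvgn (series u).
Proof. by case=> D /geo_norm_cvg /normed_cvg. Qed.

Lemma rsum_le u D : (forall j, `|u j| <= D * 2^-1 ^+ j) -> `|rsum u| <= 2 * D.
Proof.
move=> uD; apply: (le_trans (lim_series_norm (geo_norm_cvg uD))).
have h := @cvg_geometric_series _ D _ half_norm_lt1.
have -> : 2 * D = limn (series (geometric D 2^-1)).
  by rewrite (cvg_lim _ h) //; field.
apply: lim_series_le => //; first exact: geo_norm_cvg uD.
by apply/is_cvg_geometric_series/half_norm_lt1.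
Qed.

Lemma geoD u v : geo u -> geo v -> geo (fun j => u j + v j).
Proof.
move=> [D hD] [E hE]; exists (D + E) => j.
by rewrite mulrDl (le_trans (ler_normD _ _)) // lerD.
Qed.

Lemma geoZ c u : geo u -> geo (fun j => c * u j).
Proof.
move=> [D hD]; exists (`|c| * D) => j.
by rewrite normrM -mulrA ler_wpM2l.
Qed.

Lemma rsumD u v : geo u -> geo v -> rsum (fun j => u j + v j) = rsum u + rsum v.
Proof. by move=> /geo_cvg hu /geo_cvg hv; rewrite /rsum -lim_seriesD. Qed.

Lemma rsumZ c u : geo u -> rsum (fun j => c * u j) = c * rsum u.
Proof. by move=> /geo_cvg hu; exact: (lim_seriesZ c hu). Qed.

Lemma rsum0 : rsum (fun=> 0) = 0.
Proof.
apply/eqP; rewrite -normr_le0.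
have := @rsum_le (fun=> 0) 0; rewrite mulr0; apply => j.
by rewrite normr0 mul0r.
Qed.

Lemma rsum_finite u N : (forall j, (N <= j)%N -> u j = 0) ->
  rsum u = \sum_(j < N) u j.
Proof.
move=> u0; apply: cvg_lim => //; apply: (@cvg_near_cst _ _ _ _ _ _).
near=> n; rewrite seriesEord /= -(big_mkord xpredT u) -(big_mkord xpredT u).
have Nn : (N <= n)%N by near: n; exact: nbhs_infty_ge.
rewrite (big_cat_nat _ Nn) //= [X in _ + X]big_nat_cond [X in _ + X]big1 ?addr0 //.
by move=> i /andP[/andP[Ni _] _]; rewrite u0.
Unshelve. all: by end_near. Qed.

(** Only the tail has to obey the constant [D]; the head may be arbitrarily large. This separates
    the dominant mode of an orbit from the modes beyond it. *)
Lemma rsum_tail u N D : geo u ->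
  (forall j, (N <= j)%N -> `|u j| <= D * 2^-1 ^+ j) ->
  `|rsum u - \sum_(j < N) u j| <= 2 * D.
Proof.
move=> gu uD.
have D0 : 0 <= D.
  have := uD N (leqnn _).
  by move/(le_trans (normr_ge0 _)); rewrite pmulr_lge0 // exprn_gt0 // invr_gt0.
pose h j := if (j < N)%N then u j else 0.
have ht : forall j, `|u j - h j| <= D * 2^-1 ^+ j.
  move=> j; rewrite /h; case: ltnP => jN; last by rewrite subr0 uD.
  by rewrite subrr normr0 mulr_ge0 // exprn_ge0 // invr_ge0.
have gt : geo (fun j => u j + -1 * h j) by exists D => j; rewrite mulN1r.
have gh : geo h.
  case: gu => E uE; exists E => j; rewrite /h; case: ltnP => // _.
  by rewrite normr0; apply: le_trans (uE j).
have -> : \sum_(j < N) u j = rsum h.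
  rewrite (@rsum_finite h N); last by move=> j; rewrite /h ltnNge => ->.
  by apply: eq_bigr => i _; rewrite /h ltn_ord.
rewrite -mulN1r -rsumZ // -rsumD //; last exact: geoZ.
by apply: rsum_le => j; rewrite mulN1r.
Qed.

End GeometricSums.

(** * Modulus and geometrically bounded series of complex numbers *)

Section Cplx.
Variable R : realType.
Local Notation C := R[i].
Implicit Types (z w : C) (u v : nat -> C) (D : R).

(** The norm of [R[i]] takes its values in [R[i]]; estimates need a modulus with values in the
    ordered field [R]. *)
Definition cabs z : R := Normc.normc z.
Arguments cabs : simpl never.

Lemma norm_cabs z : `|z| = ((cabs z)%:C)%C. Proof. by case: z. Qed.
Lemma cabs_def z : cabs z = Num.sqrt (complex.Re z ^+ 2 + complex.Im z ^+ 2).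
Proof. by case: z. Qed.
Lemma cabs_ge0 z : 0 <= cabs z. Proof. by rewrite cabs_def sqrtr_ge0. Qed.
Lemma cabsM z w : cabs (z * w) = cabs z * cabs w. Proof. exact: Normc.normcM. Qed.
Lemma cabsD z w : cabs (z + w) <= cabs z + cabs w. Proof. exact: le_normcD. Qed.
Lemma cabsN z : cabs (- z) = cabs z. Proof. exact: normcN. Qed.
Lemma cabs0 : cabs 0 = 0. Proof. exact: Normc.normc0. Qed.
Lemma cabs1 : cabs 1 = 1. Proof. exact: Normc.normc1. Qed.
Lemma cabsX z n : cabs (z ^+ n) = cabs z ^+ n.
Proof. by elim: n => [|n IH]; rewrite ?expr0 ?cabs1 // !exprS cabsM IH. Qed.
Lemma cabs_real (x : R) : cabs (x%:C)%C = `|x|.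
Proof. by rewrite cabs_def /= expr0n /= addr0 sqrtr_sqr. Qed.
Lemma cabs_nat n : cabs n%:R = n%:R.
Proof.
have -> : (n%:R : C) = (n%:R%:C)%C by rewrite (rmorph_nat (real_complex R)).
by rewrite cabs_real ger0_norm.
Qed.
Lemma cabs_i : cabs ('i)%C = 1.
Proof. by rewrite cabs_def /= expr0n /= expr1n add0r sqrtr1. Qed.
Lemma cabs_conj z : cabs (z^*)%C = cabs z.
Proof. by case: z => a b; rewrite !cabs_def /= sqrrN. Qed.

Lemma cabs_sum (I : Type) (r : seq I) (P : pred I) (F : I -> C) :
  cabs (\sum_(i <- r | P i) F i) <= \sum_(i <- r | P i) cabs (F i).
Proof.
elim/big_rec2 : _ => [|i y x _ h]; first by rewrite cabs0.
by rewrite (le_trans (cabsD _ _)) // lerD2l.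
Qed.

Lemma Re_le z : `|complex.Re z| <= cabs z.
Proof. by rewrite cabs_def -sqrtr_sqr ler_wsqrtr // lerDl sqr_ge0. Qed.
Lemma Im_le z : `|complex.Im z| <= cabs z.
Proof. by rewrite cabs_def -sqrtr_sqr ler_wsqrtr // lerDr sqr_ge0. Qed.
Lemma cabs_le_ReIm z : cabs z <= `|complex.Re z| + `|complex.Im z|.
Proof.
have -> : z = (complex.Re z)%:C%C + 'i%C * (complex.Im z)%:C%C by rewrite -complexE.
by rewrite (le_trans (cabsD _ _)) // cabsM cabs_i mul1r !cabs_real
  -complexE lexx.
Qed.

Lemma ReD z w : complex.Re (z + w) = complex.Re z + complex.Re w.
Proof. by case: z w => ? ? []. Qed.
Lemma ImD z w : complex.Im (z + w) = complex.Im z + complex.Im w.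
Proof. by case: z w => ? ? []. Qed.
Lemma ReM z w : complex.Re (z * w) =
  complex.Re z * complex.Re w - complex.Im z * complex.Im w.
Proof. by case: z w => ? ? []. Qed.
Lemma ImM z w : complex.Im (z * w) =
  complex.Re z * complex.Im w + complex.Im z * complex.Re w.
Proof. by case: z w => ? ? []. Qed.
Lemma ReN z : complex.Re (- z) = - complex.Re z. Proof. by case: z. Qed.
Lemma ImN z : complex.Im (- z) = - complex.Im z. Proof. by case: z. Qed.
Lemma ReZ (a : R) z : complex.Re ((a%:C)%C * z) = a * complex.Re z.
Proof. by rewrite ReM /= mul0r subr0. Qed.
Lemma ImZ (a : R) z : complex.Im ((a%:C)%C * z) = a * complex.Im z.
Proof. by rewrite ImM /= mul0r addr0. Qed.
Lemma Re_sum (I : Type) (r : seq I) (P : pred I) (F : I -> C) :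
  complex.Re (\sum_(i <- r | P i) F i) = \sum_(i <- r | P i) complex.Re (F i).
Proof. exact: (big_morph (@complex.Re R) ReD erefl). Qed.
Lemma ceqP z w : complex.Re z = complex.Re w -> complex.Im z = complex.Im w -> z = w.
Proof. by case: z w => [a b] [c d] /= -> ->. Qed.

Definition csum u : C :=
  (rsum (fun j => complex.Re (u j)) +i* rsum (fun j => complex.Im (u j)))%C.
Definition cgeo u := exists D, forall j, cabs (u j) <= D * 2^-1 ^+ j.

Lemma cgeo_Re u : cgeo u -> geo (fun j => complex.Re (u j)).
Proof. by case=> D uD; exists D => j; apply: le_trans (uD j); exact: Re_le. Qed.
Lemma cgeo_Im u : cgeo u -> geo (fun j => complex.Im (u j)).
Proof. by case=> D uD; exists D => j; apply: le_trans (uD j); exact: Im_le. Qed.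

Lemma csum_le u D : (forall j, cabs (u j) <= D * 2^-1 ^+ j) -> cabs (csum u) <= 4 * D.
Proof.
move=> uD; rewrite (le_trans (cabs_le_ReIm _)) //= (_ : 4 * D = 2 * D + 2 * D); last by ring.
by apply: lerD; apply: rsum_le => j; apply: le_trans (uD j); rewrite ?Re_le ?Im_le.
Qed.

Lemma cgeoD u v : cgeo u -> cgeo v -> cgeo (fun j => u j + v j).
Proof.
move=> [D hD] [E hE]; exists (D + E) => j.
by rewrite mulrDl (le_trans (cabsD _ _)) // lerD.
Qed.

Lemma cgeoZ c u : cgeo u -> cgeo (fun j => c * u j).
Proof.
move=> [D hD]; exists (cabs c * D) => j.
by rewrite cabsM -mulrA ler_wpM2l // cabs_ge0.
Qed.

Lemma csumD u v : cgeo u -> cgeo v -> csum (fun j => u j + v j) = csum u + csum v.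
Proof.
move=> hu hv; apply: ceqP; rewrite /csum ?ReD ?ImD /= -rsumD;
  do ?[exact: cgeo_Re | exact: cgeo_Im];
  by congr rsum; apply/funext => j; rewrite ?ReD ?ImD.
Qed.

Lemma csumZ c u : cgeo u -> csum (fun j => c * u j) = c * csum u.
Proof.
move=> hu; have [hr hi] := (cgeo_Re hu, cgeo_Im hu).
apply: ceqP; rewrite /csum ?ReM ?ImM /=.
  rewrite -mulNr -!rsumZ // -rsumD; do ?exact: geoZ.
  by congr rsum; apply/funext => j; rewrite ReM mulNr.
rewrite -!rsumZ // -rsumD; do ?exact: geoZ.
by congr rsum; apply/funext => j; rewrite ImM.
Qed.

Lemma csum0 : csum (fun=> 0) = 0.
Proof. by apply: ceqP; rewrite /= rsum0. Qed.

Lemma cgeo0 : cgeo (fun=> 0).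
Proof. by exists 0 => j; rewrite cabs0 mul0r. Qed.

Lemma cgeo_sum (I : Type) (r : seq I) (P : pred I) (F : I -> nat -> C) :
  (forall i, cgeo (F i)) -> cgeo (fun j => \sum_(i <- r | P i) F i j).
Proof.
move=> hF; elim: r => [|i r IH].
  by under eq_fun do rewrite big_nil; exact: cgeo0.
under eq_fun do rewrite big_cons; case: (P i) => //; exact: cgeoD.
Qed.

Lemma csum_sum (I : Type) (r : seq I) (P : pred I) (F : I -> nat -> C) :
  (forall i, cgeo (F i)) ->
  csum (fun j => \sum_(i <- r | P i) F i j) = \sum_(i <- r | P i) csum (F i).
Proof.
move=> hF; elim: r => [|i r IH].
  by under eq_fun do rewrite big_nil; rewrite csum0 big_nil.
rewrite big_cons -IH; under eq_fun do rewrite big_cons; case: (P i) => //.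
by rewrite csumD //; exact: cgeo_sum.
Qed.

End Cplx.

Arguments cabs {R} z : simpl never.

(** * Complex exponential and Taylor estimates *)

Section RealTaylor.
Variable R : realType.

(** The intermediate point satisfies [|c| <= |x|] on either side of 0, so derivative bounds that
    increase with the modulus pass to the function with one more factor [|x|]. *)
Lemma mvt_from0 (f df : R -> R) : (forall x : R, is_derive x 1 f (df x)) ->
  forall x, exists2 c, `|c| <= `|x| & f x - f 0 = df c * x.
Proof.
move=> dfP x; have cf : continuous f.
  by move=> y; apply/differentiable_continuous/derivable1_diffP; have [] := dfP y.
case: (leP 0 x) => x0.
  have [c] := MVT_segment x0 (fun y _ => dfP y) (continuous_subspaceT cf).
  rewrite in_itv /= => /andP[c0 cx] e; exists c; last by rewrite e subr0.
  by rewrite !ger0_norm.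
have [c] := MVT_segment (ltW x0) (fun y _ => dfP y) (continuous_subspaceT cf).
rewrite in_itv /= => /andP[c0 cx] e; exists c; last by rewrite -opprB e sub0r mulrN opprK.
by rewrite !ler0_norm // ?lerN2 // ltW.
Qed.

Lemma sin_le_norm (y : R) : `|sin y| <= `|y|.
Proof.
have [c _] := mvt_from0 (fun x => is_derive_sin x) y.
by rewrite sin0 subr0 => ->; rewrite normrM ler_piMl // cos_max.
Qed.

Lemma cos_sub1_le (y : R) : `|cos y - 1| <= `|y|.
Proof.
have [c _] := mvt_from0 (fun x => is_derive_cos x) y.
by rewrite cos0 => ->; rewrite normrM normrN ler_piMl // sin_max.
Qed.

Lemma cos_sub1_le2 (y : R) : `|cos y - 1| <= `|y| ^+ 2.
Proof.
have [c cy] := mvt_from0 (fun x => is_derive_cos x) y.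
rewrite cos0 => ->; rewrite normrM normrN expr2 ler_wpM2r //.
exact: le_trans (sin_le_norm c) cy.
Qed.

Lemma sin_sub_le2 (y : R) : `|sin y - y| <= `|y| ^+ 2.
Proof.
have dP (x : R) : is_derive x 1 (fun y : R => sin y - y) (cos x - 1).
  by apply: is_deriveB.
have [c cy] := mvt_from0 dP y.
rewrite sin0 subrr subr0 => ->; rewrite normrM expr2 ler_wpM2r //.
exact: le_trans (cos_sub1_le c) cy.
Qed.

Lemma is_derive_exp_poly q (x : R) :
  is_derive x 1 (fun y : R => \sum_(l < q.+1) y ^+ l / l`!%:R)
    (\sum_(l < q) x ^+ l / l`!%:R).
Proof.
elim: q => [|q IH].
  rewrite big_ord0; under eq_fun do rewrite big_ord_recl big_ord0 expr0 addr0.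
  exact: is_derive_cst.
under eq_fun do rewrite big_ord_recr.
rewrite big_ord_recr /=.
apply: is_deriveD.
have -> : (fun y : R => y ^+ q.+1 / q.+1`!%:R) = (q.+1`!%:R^-1 \*: (fun y : R => y ^+ q.+1)).
  by apply/funext => y /=; rewrite mulrC.
have hX : is_derive x 1 (fun y : R => y ^+ q.+1) (q.+1%:R * x ^+ q).
  apply: DeriveDef; first exact: exprn_derivable.
  by rewrite exp_derive /= /GRing.scale /= mulr1.
suff -> : x ^+ q / q`!%:R = q.+1`!%:R^-1 *: (q.+1%:R * x ^+ q) by exact: is_deriveZ.
rewrite /GRing.scale /= factS natrM invfM.
have h : (q.+1%:R : R) != 0 by rewrite pnatr_eq0.
have h2 : (q`!%:R : R) != 0 by rewrite pnatr_eq0 -lt0n fact_gt0.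
by field; rewrite h2 nat1r h.
Qed.

(** The derivative of the remainder of order q+1 is the remainder of order q, so each induction step
    gains one factor [|x|]. *)
Lemma expR_taylor q (x : R) :
  `|expR x - \sum_(l < q) x ^+ l / l`!%:R| <= `|x| ^+ q * expR `|x|.
Proof.
elim: q x => [|q IH] x.
  by rewrite big_ord0 subr0 expr0 mul1r ger0_norm ?expR_ge0 // ler_expR ler_norm.
have dP (y : R) : is_derive y 1 (fun y : R => expR y - \sum_(l < q.+1) y ^+ l / l`!%:R)
    (expR y - \sum_(l < q) y ^+ l / l`!%:R).
  by apply: is_deriveB; exact: is_derive_exp_poly.
have [c cx] := mvt_from0 dP x.
have -> : \sum_(l < q.+1) (0 : R) ^+ l / l`!%:R = 1.
  rewrite big_ord_recl expr0 fact0 divr1 big1 ?addr0 // => i _.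
  by rewrite expr0n /= mul0r.
rewrite expR0 subrr subr0 => ->; rewrite normrM exprSr mulrAC ler_wpM2r //.
rewrite (le_trans (IH c)) // ler_pM ?exprn_ge0 ?expR_ge0 //.
  by rewrite lerXn2r ?nnegrE.
by rewrite ler_expR.
Qed.

End RealTaylor.

Section Cexp.
Variable R : realType.
Local Notation C := R[i].
Implicit Types (z w : C).

Definition cexp z : C :=
  ((expR (complex.Re z))%:C * (cos (complex.Im z) +i* sin (complex.Im z)))%C.

Lemma cexpD z w : cexp (z + w) = cexp z * cexp w.
Proof.
case: z w => [a b] [c d]; rewrite /cexp /=; apply: ceqP; rewrite /= expRD ?cosD ?sinD; ring.
Qed.

Lemma cexp0 : cexp 0 = 1.
Proof. by rewrite /cexp /= expR0 cos0 sin0; apply: ceqP => /=; ring. Qed.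

Lemma cabs_cexp z : cabs (cexp z) = expR (complex.Re z).
Proof.
rewrite /cexp cabsM cabs_real ger0_norm ?expR_ge0 // cabs_def /= cos2Dsin2.
by rewrite sqrtr1 mulr1.
Qed.

Lemma cexp_2pi : cexp ((2 * pi)%:C * 'i)%C = 1.
Proof.
have -> : ((2 * pi)%:C * 'i)%C = (0 +i* (2 * pi))%C :> C by apply: ceqP => /=; ring.
rewrite /cexp /= expR0 mulr_natl cos2pi sin2pi; apply: ceqP => /=; ring.
Qed.

Lemma cexp_nat n : cexp ((n%:R * (2 * pi))%:C * 'i)%C = 1.
Proof.
elim: n => [|n IH].
  by rewrite mul0r mul0r cexp0.
by rewrite -natr1 mulrDl mul1r rmorphD mulrDl cexpD IH mul1r cexp_2pi.
Qed.

Lemma cexp_int (k : int) : cexp ((k%:~R * (2 * pi))%:C * 'i)%C = 1.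
Proof.
case: k => n; first exact: cexp_nat.
have h := cexpD ((n.+1%:R * (2 * pi))%:C * 'i)%C ((- (n.+1%:R * (2 * pi)))%:C * 'i)%C.
rewrite NegzE mulrNz mulNr.
by move: h; rewrite -mulrDl -rmorphD /= subrr mul0r cexp0 cexp_nat mul1r.
Qed.

(** Real and imaginary part of the remainder split into two pieces each, every one at most
    [cabs w ^+ 2 * expR (cabs w)]; hence the 4. *)
Lemma cexp_taylor w : cabs (cexp w - 1 - w) <= 4 * cabs w ^+ 2 * expR (cabs w).
Proof.
case: w => x y; set w := (x +i* y)%C; set A := cabs w.
have hx : `|x| <= A by exact: (Re_le w).
have hy : `|y| <= A by exact: (Im_le w).
have A0 : 0 <= A by exact: cabs_ge0.
have eA : 1 <= expR A by rewrite -expR0 ler_expR.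
have ex : expR x <= expR A by rewrite ler_expR (le_trans (ler_norm x)).
have ea : expR `|x| <= expR A by rewrite ler_expR.
have sq t : `|t| <= A -> `|t| ^+ 2 <= A ^+ 2.
  by move=> ht; rewrite lerXn2r ?nnegrE.
have h2 : `|expR x - 1 - x| <= A ^+ 2 * expR A.
  have := expR_taylor 2 x; rewrite !big_ord_recl big_ord0 /= expr0 expr1 divr1.
  rewrite /bump /= addn0 (_ : 1`! = 1%N) // divr1 addr0 opprD addrA => h; apply: le_trans h _.
  by rewrite ler_pM ?expR_ge0 ?exprn_ge0 // sq.
have h1 : `|expR x - 1| <= A * expR A.
  have := expR_taylor 1 x; rewrite !big_ord_recl big_ord0 /= expr0 expr1 divr1 addr0.
  by move=> h; apply: le_trans h _; rewrite ler_pM ?expR_ge0.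
apply: le_trans (cabs_le_ReIm _) _; rewrite /cexp /=.
have -> : expR x * cos y - 0 * sin y - 1 - x =
  expR x * (cos y - 1) + (expR x - 1 - x) by ring.
have -> : expR x * sin y + 0 * cos y + - 0 - y =
  expR x * (sin y - y) + (expR x - 1) * y by ring.
have k1 : `|expR x * (cos y - 1)| <= A ^+ 2 * expR A.
  rewrite normrM [leRHS]mulrC (ger0_norm (expR_ge0 x)) ler_pM ?expR_ge0 //.
  by rewrite (le_trans (cos_sub1_le2 y)) // sq.
have k2 : `|expR x * (sin y - y)| <= A ^+ 2 * expR A.
  rewrite normrM [leRHS]mulrC (ger0_norm (expR_ge0 x)) ler_pM ?expR_ge0 //.
  by rewrite (le_trans (sin_sub_le2 y)) // sq.
have k3 : `|(expR x - 1) * y| <= A ^+ 2 * expR A.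
  by rewrite normrM expr2 [A * A * _]mulrAC ler_pM.
apply: le_trans (lerD (ler_normD _ _) (ler_normD _ _)) _.
by move: k1 k2 k3 h2; lra.
Qed.

Section Power.
Variables (s h : C) (S r : R).
Hypotheses (sS : cabs s + r <= S) (hr : cabs h <= r).

Lemma r_ge0 : 0 <= r. Proof. exact: le_trans (cabs_ge0 h) hr. Qed.
Lemma S_ge0 : 0 <= S.
Proof. by apply: le_trans sS; rewrite addr_ge0 ?cabs_ge0 ?r_ge0. Qed.
Lemma s_le_S : cabs s <= S.
Proof. by apply: le_trans sS; rewrite lerDl r_ge0. Qed.

Lemma pow_shift_le n : cabs ((s + h) ^+ n) <= S ^+ n.
Proof.
rewrite cabsX lerXn2r ?nnegrE ?cabs_ge0 ?S_ge0 //.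
by rewrite (le_trans (cabsD _ _)) // (le_trans _ sS) // lerD2l.
Qed.

Hypothesis S1 : 1 <= S.

(** Thanks to [1 <= S] the bound can carry the exponent n instead of n-1, which keeps predecessors
    out of the induction. *)
Lemma pow_diff_le n : cabs ((s + h) ^+ n - s ^+ n) <= n%:R * S ^+ n * r.
Proof.
elim: n => [|n IH]; first by rewrite !expr0 subrr cabs0 !mul0r.
have -> : (s + h) ^+ n.+1 - s ^+ n.+1 = ((s + h) ^+ n - s ^+ n) * (s + h) + s ^+ n * h.
  by rewrite !exprSr; ring.
apply: le_trans (cabsD _ _) _; rewrite !cabsM.
have h1 : cabs (s + h) <= S by have := pow_shift_le 1; rewrite !expr1.
have h2 : cabs (s ^+ n) <= S ^+ n.
  by rewrite cabsX lerXn2r ?nnegrE ?cabs_ge0 ?S_ge0 // s_le_S.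
have h3 : S ^+ n <= S ^+ n.+1 by rewrite exprS ler_peMl // exprn_ge0 // S_ge0.
have -> : n.+1%:R * S ^+ n.+1 * r = n%:R * S ^+ n * r * S + S ^+ n.+1 * r.
  by rewrite -natr1 (exprSr S); ring.
apply: lerD; first by rewrite ler_pM ?cabs_ge0.
by rewrite ler_pM ?cabs_ge0 // (le_trans h2).
Qed.

Lemma pow_diff2_le n :
  cabs ((s + h) ^+ n - s ^+ n - n%:R * s ^+ n.-1 * h) <= n%:R ^+ 2 * S ^+ n * r ^+ 2.
Proof.
elim: n => [|n IH].
  by rewrite !expr0 subrr !mul0r subr0 cabs0 expr0n /= !mul0r.
have -> : (s + h) ^+ n.+1 - s ^+ n.+1 - n.+1%:R * s ^+ n * h =
   ((s + h) ^+ n - s ^+ n - n%:R * s ^+ n.-1 * h) * s + ((s + h) ^+ n - s ^+ n) * h.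
  have -> : n.+1%:R * s ^+ n * h = n%:R * (s ^+ n.-1 * s) * h + s ^+ n * h.
    case: n {IH} => [|n]; first by rewrite !mul0r mul1r add0r.
    by rewrite -exprSr -natr1 mulrDl mul1r mulrDl.
  by rewrite !exprSr; ring.
apply: le_trans (cabsD _ _) _; rewrite !cabsM.
have r0 := r_ge0; have S0 := S_ge0.
apply: (@le_trans _ _ (n%:R ^+ 2 * S ^+ n * r ^+ 2 * S + n%:R * S ^+ n * r * r)).
  apply: lerD; rewrite ler_pM ?cabs_ge0 //; first exact: s_le_S.
  exact: pow_diff_le.
have -> : n.+1%:R ^+ 2 * S ^+ n.+1 * r ^+ 2 =
   n%:R ^+ 2 * S ^+ n * r ^+ 2 * S + (2 * n%:R + 1) * S ^+ n.+1 * r ^+ 2.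
  by rewrite -natr1 (exprSr S); ring.
rewrite lerD2l -mulrA -expr2 ler_wpM2r ?exprn_ge0 //.
rewrite ler_pM ?exprn_ge0 //; last by rewrite exprS ler_peMl // exprn_ge0.
by have : 0 <= n%:R :> R by []; lra.
Qed.

(** Leibniz splitting of a product; [L] will be the l1 norm of a frequency. The dependence on [n],
    [L] and [S] stays explicit because the bound is to be summed over terms with growing [n] and
    [L]. *)
Lemma pow_cexp_diff2_le n w (L : R) : 0 <= L -> cabs w <= L * r ->
  cabs ((s + h) ^+ n * cexp w - s ^+ n - n%:R * s ^+ n.-1 * h - s ^+ n * w) <=
  4 * S ^+ n * (n%:R + L) ^+ 2 * expR (L * r) * r ^+ 2.
Proof.
move=> L0 wL.
have -> : (s + h) ^+ n * cexp w - s ^+ n - n%:R * s ^+ n.-1 * h - s ^+ n * w =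
  (s + h) ^+ n * (cexp w - 1 - w) + ((s + h) ^+ n - s ^+ n) * w +
  ((s + h) ^+ n - s ^+ n - n%:R * s ^+ n.-1 * h) by ring.
apply: le_trans (cabsD _ _) _; apply: le_trans (lerD (cabsD _ _) (lexx _)) _.
rewrite !(cabsM _ (_ - w)) (cabsM _ w).
have r0 := r_ge0; have S0 := S_ge0.
set E := expR (L * r).
have E1 : 1 <= E by rewrite /E -expR0 ler_expR mulr_ge0.
have Sn : 0 <= S ^+ n by rewrite exprn_ge0.
have a1 : cabs ((s + h) ^+ n) * cabs (cexp w - 1 - w) <= S ^+ n * (4 * (L * r) ^+ 2 * E).
  rewrite ler_pM ?cabs_ge0 ?pow_shift_le //.
  apply: le_trans (cexp_taylor w) _.
  rewrite ler_pM ?mulr_ge0 ?expR_ge0 ?exprn_ge0 ?cabs_ge0 ?ler_expR //.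
  by rewrite ler_wpM2l // lerXn2r ?nnegrE ?cabs_ge0 // mulr_ge0.
have a2 : cabs ((s + h) ^+ n - s ^+ n) * cabs w <= n%:R * S ^+ n * r * (L * r).
  by rewrite ler_pM ?cabs_ge0 // pow_diff_le.
have a3 := pow_diff2_le n.
have n0 : 0 <= n%:R :> R by [].
apply: le_trans (lerD (lerD a1 a2) a3) _.
have -> : S ^+ n * (4 * (L * r) ^+ 2 * E) + n%:R * S ^+ n * r * (L * r) + n%:R ^+ 2 * S ^+ n * r ^+ 2
  = S ^+ n * r ^+ 2 * (4 * L ^+ 2 * E + (n%:R * L + n%:R ^+ 2)) by ring.
have -> : 4 * S ^+ n * (n%:R + L) ^+ 2 * E * r ^+ 2 =
   S ^+ n * r ^+ 2 * (4 * L ^+ 2 * E + (8 * n%:R * L + 4 * n%:R ^+ 2) * E) by ring.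
rewrite ler_wpM2l ?mulr_ge0 ?exprn_ge0 // lerD2l.
have p1 : 0 <= n%:R * L by rewrite mulr_ge0.
have p2 : 0 <= n%:R ^+ 2 :> R by rewrite exprn_ge0.
apply: (@le_trans _ _ ((8 * n%:R * L + 4 * n%:R ^+ 2) * 1)).
  by rewrite mulr1 -mulrA; move: p1 p2; set u := n%:R * L; set v := _ ^+ 2; lra.
by rewrite ler_wpM2l // addr_ge0 ?mulr_ge0 // -mulrA mulr_ge0.
Qed.

End Power.
End Cexp.

(** * Series of exponential monomials *)

Section Frechet.
Variables (R : realType) (I : finType).
Local Notation C := R[i].
Implicit Types (F : (I -> C) -> C) (z v G : I -> C).

(** Frechet differentiability in the sup norm with a quadratic remainder. Unlike an o-estimate it
    can be summed over a series, and it yields both [holo_on] and real derivatives. *)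
Definition quad_diff F z G := exists B r0 : R, [/\ 0 <= B, 0 < r0 &
  forall (r : R) v, 0 <= r -> r <= r0 -> (forall x, cabs (v x) <= r) ->
  cabs (F (fun x => z x + v x) - F z - \sum_x G x * v x) <= B * r ^+ 2].

Lemma quad_diff_linear (a : I -> C) z : quad_diff (fun z => \sum_x a x * z x) z a.
Proof.
exists 0, 1; split => // r v _ _ _; rewrite mul0r.
rewrite (_ : _ - _ - _ = 0) ?cabs0 //.
by under eq_bigr do rewrite mulrDr; rewrite big_split /=; ring.
Qed.

Lemma quad_diff_coord x0 z : quad_diff (fun z => z x0) z (fun x => (x == x0)%:R).
Proof.
have [B [r [B0 r0 h]]] := quad_diff_linear (fun x => (x == x0)%:R) z.
exists B, r; split => // t v t0 tr hv; have := h _ _ t0 tr hv.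
have e (u : I -> C) : \sum_x (x == x0)%:R * u x = u x0.
  rewrite (bigD1 x0) //= eqxx mul1r big1 ?addr0 // => x /negPf ->; exact: mul0r.
by rewrite !e.
Qed.

Lemma quad_diffD F F' z G G' : quad_diff F z G -> quad_diff F' z G' ->
  quad_diff (fun z => F z + F' z) z (fun x => G x + G' x).
Proof.
move=> [B [r [B0 r0 h]]] [B' [r' [B'0 r'0 h']]].
exists (B + B'), (Num.min r r'); split => //; [exact: addr_ge0|by rewrite lt_min r0|].
move=> t v t0; rewrite le_min => /andP[tr tr'] hv.
rewrite mulrDl; apply: le_trans (lerD (h _ _ t0 tr hv) (h' _ _ t0 tr' hv)).
apply: le_trans (cabsD _ _).
under eq_bigr do rewrite mulrDl.
by rewrite big_split /= le_eqVlt; apply/orP; left; apply/eqP; congr cabs; ring.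
Qed.

Lemma quad_diffZ (a : C) F z G : quad_diff F z G ->
  quad_diff (fun z => a * F z) z (fun x => a * G x).
Proof.
move=> [B [r [B0 r0 h]]]; exists (cabs a * B), r; split => //.
  by rewrite mulr_ge0 // cabs_ge0.
move=> t v t0 tr hv; rewrite -mulrA.
have := ler_wpM2l (cabs_ge0 a) (h _ _ t0 tr hv); rewrite -cabsM.
rewrite !mulrBr mulr_sumr.
by under eq_bigr do rewrite mulrA.
Qed.

Lemma quad_diff_grad F z G G' : quad_diff F z G -> G =1 G' -> quad_diff F z G'.
Proof. by move=> h /funext <-. Qed.

Lemma quad_diff_holo (U : set (I -> C)) F :
  (forall p, U p -> exists G, quad_diff F p G) -> holo_on U F.
Proof.
move=> hF p Up; have [G [B [r0 [B0 r00 h]]]] := hF p Up; split.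
- move=> eps eps0; pose S := \sum_x cabs (G x).
  have S0 : 0 <= S by apply: sumr_ge0 => x _; exact: cabs_ge0.
  have K0 : 0 < B + S + 1 by rewrite ltr_wpDl // addr_ge0.
  (* With d <= 1 the remainder B d^2 is at most B d, so the increment is at most (B + S) d, strictly
     below [eps]. *)
  pose d := Num.min r0 (Num.min 1 (eps / (B + S + 1))).
  have d0 : 0 < d by rewrite !lt_min r00 ltr01 divr_gt0.
  exists d => // q _ pq.
  have hv x : cabs (q x - p x) <= d.
    have := pq x; rewrite norm_cabs ltcR => /ltW; rewrite -cabsN opprB //.
  have dr : d <= r0 by rewrite ge_min lexx.
  have d1 : d <= 1 by rewrite !ge_min lexx orbT.
  have de : d <= eps / (B + S + 1) by rewrite !ge_min lexx !orbT.
  have := h _ _ (ltW d0) dr hv.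
  rewrite (_ : (fun x => p x + (q x - p x)) = q); last by apply/funext => x; rewrite addrC subrK.
  move=> hq; rewrite norm_cabs ltcR.
  have -> : F q - F p = (F q - F p - \sum_x G x * (q x - p x)) + \sum_x G x * (q x - p x) by rewrite subrK.
  have hS : cabs (\sum_x G x * (q x - p x)) <= S * d.
    apply: le_trans (cabs_sum _ _ _) _; rewrite mulr_suml; apply: ler_sum => x _.
    by rewrite cabsM ler_wpM2l // cabs_ge0.
  apply: le_lt_trans (le_trans (cabsD _ _) (lerD hq hS)) _.
  have d2 : d ^+ 2 <= d by rewrite expr2 ler_piMr // ltW.
  have := ler_wpM2l B0 d2; move: de; rewrite ler_pdivlMr // => de; nra.
- move=> i; exists (G i) => eps eps0.
  have K0 : 0 < B + 1 by rewrite ltr_wpDl.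
  pose d := Num.min r0 (eps / (B + 1)).
  exists d; first by rewrite lt_min r00 divr_gt0.
  move=> k; rewrite norm_cabs (ltcR 0) ltcR => k0; rewrite lt_min => /andP[kr ke] _.
  have hv x : cabs (if x == i then k else 0) <= cabs k.
    by case: ifP => _ //; rewrite cabs0 ltW.
  have := h _ _ (ltW k0) (ltW kr) hv.
  rewrite (_ : (fun x => p x + _) = shiftv p i k); last first.
    by apply/funext => x; rewrite /shiftv; case: ifP; rewrite ?addr0.
  rewrite (bigD1 i) //= eqxx big1 ?addr0; last by move=> x /negPf ->; rewrite mulr0.
  move=> hq; rewrite norm_cabs -(rmorphM (real_complex R)) lecR.
  apply: le_trans hq _; rewrite expr2 mulrA ler_wpM2r ?(ltW k0) //.
  by move: ke; rewrite ltr_pdivlMr // => ke; nra.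
Qed.

End Frechet.

Section QuadDerive.
Variable R : realType.

Lemma quad_is_derive (f : R -> R) (t L B r0 : R) : 0 < r0 ->
  (forall h, `|h| <= r0 -> `|f (t + h) - f t - L * h| <= B * h ^+ 2) ->
  is_derive t 1 f L.
Proof.
move=> r00 hf.
have cv : h^-1 *: (f (h *: 1 + t) - f t) @[h --> 0^'] --> L.
  apply/cvgrPdist_le => e e0.
  pose B' := `|B| + 1; have B'0 : 0 < B' by rewrite ltr_wpDl.
  near=> h.
  have h0 : h != 0 by near: h; exact: nbhs_dnbhs_neq.
  have hr : `|h| <= Num.min r0 (e / B').
    near: h; apply: dnbhs0_le; rewrite lt_min r00 divr_gt0 //.
  move: hr; rewrite le_min => /andP[hr he].
  have -> : h *: 1 = h by rewrite /GRing.scale /= mulr1.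
  have -> : L - h^-1 *: (f (h + t) - f t) = - (h^-1 * (f (t + h) - f t - L * h)).
    by rewrite /GRing.scale /= [h + t]addrC; field.
  rewrite normrN normrM normfV ler_pdivrMl ?normr_gt0 //.
  apply: le_trans (hf _ hr) _.
  have -> : h ^+ 2 = `|h| ^+ 2 by rewrite -normrX ger0_norm // sqr_ge0.
  have n0 : 0 < `|h| by rewrite normr_gt0.
  have bB : B <= B' by rewrite /B'; have := ler_norm B; lra.
  rewrite expr2 mulrA mulrC ler_wpM2l ?(ltW n0) //.
  apply: (@le_trans _ _ (B' * `|h|)); first by rewrite ler_wpM2r // ltW.
  by rewrite mulrC -ler_pdivlMr.
apply: DeriveDef; first by apply/cvg_ex; exists L.
exact: cvg_lim cv.
Unshelve. all: by end_near. Qed.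

Variable I : finType.

(** Serves both [pder], where the direction is a unit vector, and [dmap], where it is arbitrary. *)
Lemma quad_diff_line (F : (I -> R[i]) -> R[i]) (p u : I -> R) G :
  quad_diff F (cplx p) G ->
  is_derive (0 : R) 1 (fun s => complex.Re (F (cplx (fun x => p x + s * u x))))
    (\sum_x complex.Re (G x) * u x).
Proof.
move=> [B [r0 [B0 r00 h]]].
pose S := \sum_x `|u x| + 1.
have S0 : 0 < S by rewrite ltr_wpDl // sumr_ge0.
have uS x : `|u x| <= S.
  rewrite /S (bigD1 x) //= -addrA lerDl addr_ge0 // sumr_ge0 //.
apply: (@quad_is_derive _ _ _ (B * S ^+ 2) (r0 / S)); first by rewrite divr_gt0.
move=> s; rewrite ler_pdivlMr // => sr.
have hv x : cabs ((s * u x)%:C)%C <= `|s| * S by rewrite cabs_real normrM ler_wpM2l.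
have := h _ _ (mulr_ge0 (normr_ge0 s) (ltW S0)) sr hv.
have -> : (fun x => cplx p x + (s * u x)%:C%C) = cplx (fun x => p x + (0 + s) * u x).
  by apply/funext => x; rewrite /cplx add0r rmorphD.
have -> : cplx p = cplx (fun x => p x + 0 * u x).
  by congr cplx; apply/funext => x; rewrite mul0r addr0.
move=> hq; rewrite -mulrA -exprMn [S * s]mulrC exprMn -(ger0_norm (sqr_ge0 s)) normrX -exprMn.
apply: le_trans hq; apply: le_trans _ (Re_le _).
rewrite !ReD !ReN Re_sum mulr_suml le_eqVlt; apply/orP; left; apply/eqP.
congr (`| _ - _ |); apply: eq_bigr => x _.
by rewrite ReM /= mulr0 subr0; ring.
Qed.

Lemma quad_diff_pder (F : (I -> R[i]) -> R[i]) (f : (I -> R) -> R) (p : I -> R) G x :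
  (forall q, f q = complex.Re (F (cplx q))) ->
  quad_diff F (cplx p) G -> pder f p x = complex.Re (G x).
Proof.
move=> fF hG; rewrite /pder derive1E.
have := quad_diff_line (fun y => (y == x)%:R) hG.
rewrite (bigD1 x) //= eqxx mulr1 big1 ?addr0; last by move=> y /negPf ->; rewrite mulr0.
have -> : (fun s : R => complex.Re (F (cplx (fun y => p y + s * (y == x)%:R)))) =
  (fun s => f (shiftv p x s)).
  apply/funext => s; rewrite fF; congr (complex.Re (F (cplx _))).
  by apply/funext => y; rewrite /shiftv; case: eqP => _; rewrite ?mulr1 // mulr0 addr0.
by move=> hd; rewrite derive_val.
Qed.

End QuadDerive.

(** * Termwise differentiation of families of exponential monomials *)

Section ExpFamily.
Variables (R : realType) (I : finType) (sx : I).
Local Notation C := R[i].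
Variable M : nat -> R.
Implicit Types (l z v : I -> C) (nu : nat -> nat) (la : nat -> I -> C) (c : nat -> C).

Definition lin l z : C := \sum_x l x * z x.
Definition lnorm l : R := \sum_x cabs (l x).
Definition fterm n l (c : C) z : C := c * z sx ^+ n * cexp (lin l z).
Definition fam nu la c z : C := csum (fun j => fterm (nu j) (la j) (c j) z).

(** Degrees are linear in M_j, but frequencies contain m_j = (j+1) M_j, which is not; they are only
    required to be exponential in M_j. Whatever differentiation brings down is then at most
    [expR (K * M j)] for some [K]. *)
Definition tame nu la := exists2 K : R, 0 <= K &
  forall j, (nu j)%:R <= K * M j /\ lnorm (la j) <= expR (K * M j).
(** The term [rho * lnorm (la j)] covers a whole polydisc around [z], and the quantifier over all
    [K] absorbs every [moderate] factor, so the condition survives differentiation. *)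
Definition adm la c z := exists2 rho : R, 0 < rho & forall K : R, exists D : R, forall j,
  cabs (c j) * expR (complex.Re (lin (la j) z) + rho * lnorm (la j) + K * M j)
  <= D * 2^-1 ^+ j.
Definition moderate (a : nat -> C) := exists K : R, forall j, cabs (a j) <= expR (K * M j).

Lemma lnorm_ge0 l : 0 <= lnorm l.
Proof. by apply: sumr_ge0 => x _; exact: cabs_ge0. Qed.

Lemma linD l z v : lin l (fun x => z x + v x) = lin l z + lin l v.
Proof. by rewrite /lin -big_split; apply: eq_bigr => x _; rewrite mulrDr. Qed.

Lemma lin_le l v (r : R) : (forall x, cabs (v x) <= r) -> cabs (lin l v) <= lnorm l * r.
Proof.
move=> hv; apply: le_trans (cabs_sum _ _ _) _; rewrite mulr_suml; apply: ler_sum => x _.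
by rewrite cabsM ler_wpM2l // cabs_ge0.
Qed.

Lemma adm_mul la c z a : adm la c z -> moderate a -> adm la (fun j => a j * c j) z.
Proof.
move=> [rho rho0 h] [K aK]; exists rho => // K'; have [D hD] := h (K + K').
exists D => j; apply: le_trans (hD j).
have -> : expR (complex.Re (lin (la j) z) + rho * lnorm (la j) + (K + K') * M j) =
  expR (K * M j) * expR (complex.Re (lin (la j) z) + rho * lnorm (la j) + K' * M j).
  by rewrite -expRD; congr expR; ring.
rewrite cabsM [in leRHS]mulrCA -mulrA.
by rewrite ler_wpM2r ?mulr_ge0 ?cabs_ge0 ?expR_ge0.
Qed.

Lemma adm_add la c c' z : adm la c z -> adm la c' z -> adm la (fun j => c j + c' j) z.
Proof.
move=> [rho rho0 h] [rho' rho'0 h']; exists (Num.min rho rho').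
  by rewrite lt_min rho0.
move=> K; have [D hD] := h K; have [D' hD'] := h' K.
exists (D + D') => j; rewrite mulrDl; apply: le_trans (lerD (hD j) (hD' j)).
apply: le_trans (ler_wpM2r (expR_ge0 _) (cabsD _ _)) _; rewrite mulrDl.
by apply: lerD; rewrite ler_wpM2l ?cabs_ge0 // ler_expR lerD2r lerD2l
  ler_wpM2r ?lnorm_ge0 // ge_min lexx ?orbT.
Qed.

Lemma moderate_freq nu la x : tame nu la -> moderate (fun j => la j x).
Proof.
move=> [K K0 h]; exists K => j; apply: le_trans (h j).2.
by rewrite /lnorm (bigD1 x) //= lerDl sumr_ge0 // => y _; exact: cabs_ge0.
Qed.

Lemma moderate_nu nu la : tame nu la -> moderate (fun j => (nu j)%:R).
Proof.
move=> [K K0 h]; exists K => j; rewrite cabs_nat; apply: le_trans (h j).1 _.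
by apply: le_trans (expR_ge1Dx _); rewrite lerDr.
Qed.

Lemma tame_pred nu la : tame nu la -> tame (fun j => (nu j).-1) la.
Proof.
move=> [K K0 h]; exists K => // j; split; last exact: (h j).2.
by apply: le_trans (h j).1; rewrite ler_nat leq_pred.
Qed.

Lemma expr_le_expR (S : R) n : 0 <= S -> S ^+ n <= expR (S * n%:R).
Proof.
move=> S0; rewrite mulrC expRM_natl lerXn2r ?nnegrE ?expR_ge0 //.
by apply: le_trans (expR_ge1Dx _); rewrite lerDr.
Qed.

Lemma fterm_le n l (a : C) z v (r : R) : 0 <= r -> (forall x, cabs (v x) <= r) ->
  cabs (fterm n l a (fun x => z x + v x)) <=
  cabs a * expR (complex.Re (lin l z) + lnorm l * r + (cabs (z sx) + r) * n%:R).
Proof.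
move=> r0 hv; rewrite /fterm cabsM (cabsM a) -mulrA ler_wpM2l ?cabs_ge0 //.
rewrite cabs_cexp mulrC expRD.
have S0 : 0 <= cabs (z sx) + r by rewrite addr_ge0 ?cabs_ge0.
apply: ler_pM; rewrite ?expR_ge0 ?cabs_ge0 //.
  rewrite ler_expR linD ReD lerD2l (le_trans (ler_norm _)) // (le_trans (Re_le _)) //.
  exact: lin_le.
apply: le_trans (expr_le_expR _ S0); apply: pow_shift_le (hv sx) _.
by [].
Qed.

Lemma fterm_cgeo nu la c z : tame nu la -> adm la c z ->
  exists2 r0 : R, 0 < r0 & forall v, (forall x, cabs (v x) <= r0) ->
    cgeo (fun j => fterm (nu j) (la j) (c j) (fun x => z x + v x)).
Proof.
move=> [K K0 tK] [rho rho0 h]; exists rho => // v hv.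
have [D hD] := h ((cabs (z sx) + rho) * K).
exists D => j; apply: le_trans (hD j); apply: le_trans (fterm_le _ _ _ _ (ltW rho0) hv) _.
rewrite ler_wpM2l ?cabs_ge0 // ler_expR [rho * _]mulrC lerD2l -mulrA ler_wpM2l //.
  by rewrite addr_ge0 ?cabs_ge0 // ltW.
exact: (tK j).1.
Qed.

Lemma fterm_cgeo0 nu la c z : tame nu la -> adm la c z ->
  cgeo (fun j => fterm (nu j) (la j) (c j) z).
Proof.
move=> ht ha; have [r0 r00 h] := fterm_cgeo ht ha.
have := h (fun=> 0); rewrite (_ : (fun x => z x + 0) = z); last by apply/funext => x; rewrite addr0.
by apply => x; rewrite cabs0 ltW.
Qed.

(** The second family comes from the power of the distinguished variable [sx]; at [nu j = 0] its
    predecessor is harmless because the coefficient vanishes. *)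
Definition fam_grad nu la c z x : C :=
  fam nu la (fun j => la j x * c j) z +
  (x == sx)%:R * fam (fun j => (nu j).-1) la (fun j => (nu j)%:R * c j) z.

(** The remainder of the sum is the sum of the remainders, and [pow_cexp_diff2_le] bounds each by
    r^2 times a quantity that [adm] makes summable. *)
Lemma fam_quad_diff nu la c z : tame nu la -> adm la c z ->
  quad_diff (fam nu la c) z (fam_grad nu la c z).
Proof.
move=> ht ha; have [r1 r10 hg] := fterm_cgeo ht ha.
have [[K K0 tK] [rho rho0 h]] := (ht, ha).
pose S := cabs (z sx) + 1.
have S1 : 1 <= S by rewrite /S lerDr cabs_ge0.
have S0 : 0 <= S by apply: le_trans S1.
(* [S * K] pays for the power [S ^+ n], [2 * K] for the squared sum of degree and frequency norm;
   [rho] pays for the variation of the exponential. *)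
have [D hD] := h (S * K + 2 * K).
have D0 : 0 <= D.
  have := hD 0%N; rewrite expr0 mulr1; apply: le_trans.
  by rewrite mulr_ge0 ?cabs_ge0 ?expR_ge0.
pose r0 := Num.min r1 (Num.min 1 rho).
(* 16 = 4 * 4: one 4 from [pow_cexp_diff2_le], one from squaring
   [n%:R + lnorm l <= 2 * expR (K * M j)]. The outer 4 is that of [csum_le]. *)
exists (4 * (16 * D)), r0; split; first by rewrite !mulr_ge0.
  by rewrite !lt_min r10 ltr01.
move=> r v rp; rewrite !le_min => /and3P[rr1 rle1 rrho] hv.
pose g x j := fterm (nu j) (la j) (la j x * c j) z +
  (x == sx)%:R * fterm (nu j).-1 (la j) ((nu j)%:R * c j) z.
have g1 x : cgeo (fun j => fterm (nu j) (la j) (la j x * c j) z).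
  by apply: (fterm_cgeo0 ht); apply: adm_mul => //; exact: moderate_freq ht.
have g2 : cgeo (fun j => fterm (nu j).-1 (la j) ((nu j)%:R * c j) z).
  by apply: (fterm_cgeo0 (tame_pred ht)); apply: adm_mul => //; exact: moderate_nu ht.
have gg x : cgeo (g x) by apply: cgeoD => //; exact: cgeoZ.
have Gg x : fam_grad nu la c z x = csum (g x).
  by rewrite csumD //; [rewrite csumZ | exact: cgeoZ].
have gv : cgeo (fun j => fterm (nu j) (la j) (c j) (fun x => z x + v x)).
  by apply: hg => x; apply: le_trans (hv x) rr1.
have gz := fterm_cgeo0 ht ha.
have gs : cgeo (fun j => \sum_x v x * g x j) by apply: cgeo_sum => x; exact: cgeoZ.
have -> : fam nu la c (fun x => z x + v x) - fam nu la c z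
    - \sum_x fam_grad nu la c z x * v x =
  csum (fun j => fterm (nu j) (la j) (c j) (fun x => z x + v x) +
     (-1) * fterm (nu j) (la j) (c j) z + (-1) * \sum_x v x * g x j).
  rewrite csumD; [|by apply: cgeoD => //; exact: cgeoZ|exact: cgeoZ].
  rewrite csumD //; last exact: cgeoZ.
  rewrite !csumZ // csum_sum; last by move=> x; exact: cgeoZ.
  rewrite !mulN1r; congr (_ - _); apply: eq_bigr => x _.
  by rewrite csumZ // Gg mulrC.
rewrite -mulrA; apply: csum_le => j.
rewrite mulrAC.
set s := z sx; set n := nu j; set l := la j; set w := lin l v; set hh := v sx.
have -> : fterm n l (c j) (fun x => z x + v x) + -1 * fterm n l (c j) z
    + -1 * (\sum_x v x * g x j) =
  c j * cexp (lin l z) * ((s + hh) ^+ n * cexp w - s ^+ n - n%:R * s ^+ n.-1 * hh - s ^+ n * w).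
  have -> : \sum_x v x * g x j = c j * cexp (lin l z) * (s ^+ n * w + n%:R * s ^+ n.-1 * hh).
    rewrite /g; under eq_bigr do rewrite mulrDr.
    rewrite big_split /= [X in _ + X](bigD1 sx) //= eqxx mul1r [X in _ + (_ + X)]big1.
      rewrite addr0 mulrDr; congr (_ + _); last by rewrite /fterm -/n -/l -/s -/hh; ring.
      rewrite /w /lin mulr_sumr mulr_sumr; apply: eq_bigr => x _.
      by rewrite /fterm -/n -/l -/s /lin; ring.
    by move=> x /negPf ->; rewrite mul0r mulr0.
  by rewrite /fterm linD cexpD -/s -/hh -/w; ring.
have L0 := lnorm_ge0 l.
rewrite cabsM cabsM cabs_cexp.
have sS : cabs s + r <= S by rewrite lerD2l.
have est := pow_cexp_diff2_le sS (hv sx) S1 n L0 (lin_le l hv).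
apply: le_trans (ler_wpM2l _ est) _; first by rewrite mulr_ge0 ?cabs_ge0 ?expR_ge0.
rewrite mulrA ler_wpM2r ?exprn_ge0 //.
rewrite -[16 * D * _]mulrA; apply: le_trans (ler_wpM2l (ler0n _ 16) (hD j)).
have nK : n%:R + lnorm l <= 2 * expR (K * M j).
  rewrite mulr_natl mulr2n lerD //; last exact: (tK j).2.
  apply: le_trans (tK j).1 _.
  by apply: le_trans (expR_ge1Dx _); rewrite lerDr.
have sq : (n%:R + lnorm l) ^+ 2 <= 4 * expR (2 * K * M j).
  have -> : 4 * expR (2 * K * M j) = (2 * expR (K * M j)) ^+ 2.
    by rewrite exprMn -mulrA expRM_natl; congr (_ * _); rewrite -natrX.
  by rewrite lerXn2r ?nnegrE ?mulr_ge0 ?expR_ge0 // addr_ge0.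
have Sn : S ^+ n <= expR (S * K * M j).
  apply: le_trans (expr_le_expR _ S0) _; rewrite ler_expR -mulrA ler_wpM2l //.
  exact: (tK j).1.
have eL : expR (lnorm l * r) <= expR (rho * lnorm l).
  by rewrite ler_expR mulrC ler_wpM2r.
rewrite !expRD (mulrDl (S * K)) expRD -/l.
set a := cabs (c j); set e := expR (complex.Re _).
have a0 : 0 <= a by exact: cabs_ge0.
have -> : 16 * (a * (e * expR (rho * lnorm l) * (expR (S * K * M j) * expR (2 * K * M j)))) =
  a * (e * (4 * expR (S * K * M j) * (4 * expR (2 * K * M j)) * expR (rho * lnorm l))) by ring.
rewrite -[a * e * _]mulrA ler_wpM2l // ler_wpM2l ?expR_ge0 //.
have Sn0 : 0 <= 4 * S ^+ n by rewrite mulr_ge0 ?exprn_ge0.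
have nL0 : 0 <= (n%:R + lnorm l) ^+ 2 by rewrite exprn_ge0 // addr_ge0.
have S4 : 4 * S ^+ n <= 4 * expR (S * K * M j) by rewrite ler_wpM2l.
apply: ler_pM eL; rewrite ?expR_ge0 // ?(mulr_ge0 Sn0) //.
exact: ler_pM S4 sq.
Qed.

End ExpFamily.

(** * Choice of the frequencies *)

Section Selection.
Variable R : realType.

(** Divergence to -oo lets a divisor beat any exponential rate. The exponent contains [K i + D]
    because this sum becomes the next [M]. The premise [0 < T] stands inside the existential so that
    [choice] yields a total function. *)
Lemma select_step (K : nat -> nat) (ep : nat -> R) :
  (fun j => ln (ep j) / (K j)%:R) @ \oo --> -oo ->
  forall (D : nat) (T : R), exists i, 0 < T ->
    0 < ep i /\ ep i <= T * expR (- (D%:R * (K i + D)%N%:R)).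
Proof.
move=> hcv D T; case: (ltP 0 T) => [T0|]; last by exists 0%N.
(* For K >= 1 the product A K dominates D K + D^2 - ln T, the exponent required. *)
pose A : R := D%:R + D%:R ^+ 2 + `|ln T|.
have A0 : 0 <= A by rewrite !addr_ge0 // exprn_ge0.
have [N _ hN] := proj1 (cvgrNyPlt _) hcv (- A).
have := hN N (leqnn N) => /= {hN}.
(* A zero frequency would make the quotient 0, by the convention x / 0 = 0, against a value below
   -A. *)
case eK : (K N) => [|k] hN.
  by move: hN; rewrite invr0 mulr0 oppr_gt0 ltNge A0.
exists N => _; rewrite eK.
have k1 : 1 <= k.+1%:R :> R by rewrite ler1n.
move: hN; rewrite ltr_pdivrMr ?ltr0n // => hN.
(* [ln] is 0 at nonpositive arguments, so a vanishing divisor is excluded in the same way. *)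
have ep0 : 0 < ep N.
  rewrite ltNge; apply/negP => /ln0 e0; move: hN; rewrite e0 mulNr oppr_gt0 ltNge.
  by rewrite mulr_ge0.
split => //; rewrite -[ep N]lnK ?posrE // -[T in T * _]lnK ?posrE // -expRD ler_expR.
have h1 : `|ln T| <= `|ln T| * k.+1%:R by rewrite ler_peMr.
have h2 : D%:R ^+ 2 <= D%:R ^+ 2 * k.+1%:R :> R by rewrite ler_peMr // exprn_ge0.
have h3 : - ln T <= `|ln T| by rewrite -normrN ler_norm.
apply: ltW; apply: lt_le_trans hN _; rewrite /A natrD.
by move: h1 h2 h3; set u := `|ln T|; set v : R := D%:R; set w : R := k.+1%:R; nra.
Qed.

Lemma select_subsequence (K : nat -> nat) (ep : nat -> R) :
  (fun j => ln (ep j) / (K j)%:R) @ \oo --> -oo ->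
  exists ix M : nat -> nat, [/\ forall j, 0 < ep (ix j),
    forall j, (K (ix j) <= M j)%N, forall j, (j.+1 ^ 2 <= M j)%N /\ (M j <= M j.+1)%N,
    ep (ix 0%N) <= expR (- (M 0%N)%:R) &
    forall j, ep (ix j.+1) <= ep (ix j) * expR (- ((j.+2 ^ 2)%N%:R * (M j.+1)%:R))].
Proof.
move=> hcv.
have [f hf] := choice (fun x : nat * R => select_step hcv x.1 x.2).
(* A state is an index together with [M]. The old [M] inside [D] gives monotonicity, (j+2)^2 gives
   the lower bound and the rate, and the tolerance [ep st.1] compares each divisor with its
   predecessor. *)
pose nxt j (st : nat * nat) := let D := (st.2 + j.+2 ^ 2)%N in
  let i := f (D, ep st.1) in (i, (K i + D)%N).
pose st := fix st j : nat * nat := if j is j'.+1 then nxt j' (st j')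
  else let i := f (1%N, 1) in (i, (K i + 1)%N).
have ep0 j : 0 < ep (st j).1.
  by elim: j => [|j IH]; [have [] := hf (1%N, 1) ltr01 | have [] := hf ((st j).2 + j.+2 ^ 2, ep (st j).1)%N IH].
exists (fun j => (st j).1), (fun j => (st j).2); split => //.
- by case=> [|j] /=; rewrite leq_addr.
- move=> j; split; last by rewrite /=; lia.
  by case: j => [|j] /=; lia.
- by have [_] := hf (1%N, 1) ltr01; rewrite mul1r mul1r.
- move=> j; have [_ /=] := hf ((st j).2 + j.+2 ^ 2, ep (st j).1)%N (ep0 j).
  set i := f _ => h; apply: le_trans h _; rewrite ler_wpM2l ?(ltW (ep0 j)) //.
  by rewrite ler_expR lerN2 ler_wpM2r // ler_nat leq_addl.
Qed.

End Selection.

(** * Summability of the exponential majorants *)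

Section Majorants.
Variables (R : realType) (M : nat -> nat).
Hypothesis M2 : forall j, (j.+1 ^ 2 <= M j)%N.

Lemma M_gt j : (j < M j)%N.
Proof. by apply: leq_trans (M2 j); rewrite expnS expn1 leq_pmulr. Qed.

(** As M_j > j, the terms with q_j <= -1 are at most e^(-j) <= 2^(-j); the finitely many others are
    absorbed into [D]. *)
Lemma expR_geo (q : nat -> R) : (exists N, forall j, (N <= j)%N -> q j <= -1) ->
  exists D, forall j, expR ((M j)%:R * q j) <= D * 2^-1 ^+ j.
Proof.
move=> [N hN]; pose S := \sum_(j < N) expR ((M j)%:R * q j) * 2 ^+ j.
have S0 : 0 <= S by apply: sumr_ge0 => j _; rewrite mulr_ge0 ?expR_ge0 ?exprn_ge0.
exists (S + 1) => j; rewrite exprVn ler_pdivlMr ?exprn_gt0 //.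
case: (ltnP j N) => jN.
  apply: (@le_trans _ _ S); last by rewrite lerDl.
  rewrite /S (bigD1 (Ordinal jN)) //= lerDl; apply: sumr_ge0 => i _.
  by rewrite mulr_ge0 ?expR_ge0 ?exprn_ge0.
apply: (@le_trans _ _ 1); last by rewrite lerDr.
have h1 : expR ((M j)%:R * q j) <= expR (- j%:R).
  rewrite ler_expR; apply: (@le_trans _ _ (- (M j)%:R)).
    by rewrite -mulrN1 ler_wpM2l // hN.
  by rewrite lerN2 ler_nat ltnW // M_gt.
have h2 : 2 ^+ j <= expR j%:R :> R.
  rewrite -[j%:R]mulr1 expRM_natl lerXn2r ?nnegrE ?expR_ge0 //.
  by have := expR_ge1Dx (1 : R); rewrite -[1 + 1]/(2).
apply: le_trans (ler_pM _ _ h1 h2) _; rewrite ?expR_ge0 ?exprn_ge0 //.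
by rewrite -expRD addNr expR0.
Qed.

(** The exponent is M_j (K - sigma (j+1)), and j+1 eventually wins for every sigma > 0: this is
    convergence for Re s < 0. *)
Lemma decay_geo (sigma K : R) : 0 < sigma ->
  exists D, forall j, expR (K * (M j)%:R - sigma * (j.+1 * M j)%N%:R) <= D * 2^-1 ^+ j.
Proof.
move=> s0.
have [|D hD] := @expR_geo (fun j => K - sigma * j.+1%:R).
  have [N hN] : exists N : nat, (K + 1) / sigma <= N%:R.
    exists (Num.bound `|(K + 1) / sigma|); apply: le_trans (ler_norm _) (ltW _).
    exact: archi_boundP.
  exists N => j Nj; move: hN; rewrite ler_pdivrMr // => hN.
  have : N%:R <= j.+1%:R :> R by rewrite ler_nat leqW.
  by move=> h; have := ler_wpM2l (ltW s0) h; lra.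
exists D => j; apply: le_trans (hD j); rewrite ler_expR natrM.
by rewrite le_eqVlt; apply/orP; left; apply/eqP; ring.
Qed.

Variable e : nat -> R.
Hypothesis e_small : forall j, `|e j| <= expR (- ((j.+1 ^ 2)%N%:R * (M j)%:R)).

(** The square in [e_small] is made for this: (j+1)^2 eventually exceeds S (j+1) + K + 1 for all S
    and K, hence convergence for every complex s and angle strips of every width. *)
Lemma small_geo (S K : R) :
  exists D, forall j, `|e j| * expR (K * (M j)%:R + S * (j.+1 * M j)%N%:R) <= D * 2^-1 ^+ j.
Proof.
have [|D hD] := @expR_geo (fun j => K + S * j.+1%:R - (j.+1%:R) ^+ 2).
  pose a := `|S| + `|K| + 1.
  have [N hN] : exists N : nat, a <= N%:R.
    exists (Num.bound a); apply: ltW; apply: archi_boundP; rewrite !addr_ge0 //.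
  exists N => j Nj.
  have h : a <= j.+1%:R by apply: le_trans hN _; rewrite ler_nat leqW.
  have h1 : 1 <= j.+1%:R :> R by rewrite ler1n.
  have := ler_norm S; have := ler_norm K; have := normr_ge0 S; have := normr_ge0 K.
  move: h h1; rewrite /a; set x : R := j.+1%:R; set s := `|S|; set k := `|K|.
  by move=> *; nra.
exists D => j; apply: le_trans (hD j).
apply: le_trans (ler_wpM2r (expR_ge0 _) (e_small j)) _.
rewrite -expRD ler_expR natrM natrX.
by rewrite le_eqVlt; apply/orP; left; apply/eqP; ring.
Qed.

End Majorants.

(** * Trigonometric series *)

Section TrigFamily.
Variables (R : realType) (n : nat).
Local Notation C := R[i].
Local Notation d := n.+1.
Variables (k : nat -> 'I_d -> int) (M : nat -> nat) (e : nat -> R).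
Hypothesis M2 : forall j, (j.+1 ^ 2 <= M j)%N.
Hypothesis kM : forall j i, (`|k j i| <= M j)%N.
Implicit Types (nu : nat -> nat) (mu : nat -> R) (c : nat -> C) (z : ptT C d) (p : ptT R d).

Local Notation MR := (fun j => (M j)%:R : R).
Local Notation sx := (inr ord_max : 'I_d + 'I_d)%type.

Definition freq (sg : R) mu (j : nat) : ptT C d := fun x =>
  match x with
  | inl i => ((sg * (2 * pi * (k j i)%:~R))%:C * 'i)%C
  | inr i => if i == ord_max then ((mu j)%:C)%C else 0
  end.

Definition conjs c j : C := ((c j)^*)%C.

(** The second family has conjugate coefficients and conjugate frequencies. The sum is thus real on
    real arguments and still holomorphic, as a real part would not be. *)
Definition trig nu mu c z : C :=
  fam sx nu (freq 1 mu) c z + fam sx nu (freq (-1) mu) (conjs c) z.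

Definition tadm mu c z := adm MR (freq 1 mu) c z /\ adm MR (freq (-1) mu) (conjs c) z.

Lemma freq_conj mu j x : freq (-1) mu j x = ((freq 1 mu j x)^*)%C.
Proof.
case: x => i /=; first by apply: ceqP => /=; ring.
by case: ifP => _; apply: ceqP => /=; rewrite ?oppr0.
Qed.

Lemma conjs_mul a c : conjs (fun j => a j * c j) = (fun j => ((a j)^*)%C * conjs c j).
Proof. by apply/funext => j; rewrite /conjs rmorphM. Qed.

Lemma norm_k j i : `|(k j i)%:~R| <= (M j)%:R :> R.
Proof. by rewrite -intr_norm -abszE -pmulrn ler_nat kM. Qed.

Lemma lnorm_freq (sg : R) mu j : `|sg| = 1 -> 0 <= mu j ->
  lnorm (freq sg mu j) <= d%:R * (2 * pi) * (M j)%:R + mu j.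
Proof.
move=> sg1 mu0; rewrite /lnorm big_sumType /=; apply: lerD.
  apply: (@le_trans _ _ (\sum_(i < d) (2 * pi * (M j)%:R))).
    apply: ler_sum => i _; rewrite cabsM cabs_i mulr1 cabs_real normrM sg1 mul1r normrM.
    by rewrite ger0_norm ?mulr_ge0 ?pi_ge0 // ler_wpM2l ?mulr_ge0 ?pi_ge0 // norm_k.
  by rewrite sumr_const card_ord -[leLHS]mulr_natl mulrA lexx.
rewrite (bigD1 ord_max) //= eqxx big1 ?addr0.
  by rewrite cabs_real ger0_norm.
by move=> i /negPf ->; rewrite cabs0.
Qed.

Definition mexp j : R := (j.+1 * M j)%N%:R.
(** Two rates occur: [mexp] for the Hamiltonian and the conjugacy, and 0 for the trigonometric
    polynomials of the normal form. *)
Definition mu_ok mu := forall j, 0 <= mu j <= mexp j.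
Definition nu_ok nu := forall j, (nu j <= j.+2)%N.

Lemma M_ge1 j : 1 <= (M j)%:R :> R.
Proof. by rewrite ler1n (leq_trans _ (M2 j)) // expn_gt0. Qed.

Lemma freq_tame (sg : R) nu mu : `|sg| = 1 -> mu_ok mu -> nu_ok nu -> tame MR nu (freq sg mu).
Proof.
move=> sg1 muok nuok; pose D : R := d%:R * (2 * pi).
have D0 : 0 <= D by rewrite /D mulr_ge0 // mulr_ge0 // pi_ge0.
exists (D + 2); first by rewrite addr_ge0.
move=> j; have m1 := M_ge1 j; have /andP[mu0 mum] := muok j; split.
  apply: (@le_trans _ _ (2 * (M j)%:R)); last by rewrite ler_wpM2r // lerDr.
  rewrite -natrM ler_nat (leq_trans (nuok j)) //; have := M_gt M2 j.
  by have := M2 j; case: j {m1 mu0 mum} => [|j]; lia.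
apply: le_trans (lnorm_freq sg1 mu0) _; rewrite -/D.
apply: (@le_trans _ _ ((1 + D) * (M j)%:R ^+ 2)).
  have : mu j <= (M j)%:R ^+ 2.
    apply: le_trans mum _; rewrite /mexp natrM expr2 ler_wpM2r // ler_nat; exact: M_gt.
  have : D * (M j)%:R <= D * (M j)%:R ^+ 2 by rewrite ler_wpM2l // expr2 ler_peMr.
  by lra.
rewrite [(D + 2) * _]mulrDl expRD ler_pM ?exprn_ge0 ?addr_ge0 //.
  apply: le_trans (expR_ge1Dx D) _; rewrite ler_expR ler_peMr //.
rewrite expRM_natl lerXn2r ?nnegrE ?expR_ge0 //.
by apply: le_trans (expR_ge1Dx _); rewrite lerDr.
Qed.

Lemma Re_lin_freq (sg : R) mu j z : `|sg| = 1 ->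
  complex.Re (lin (freq sg mu j) z) <=
  mu j * complex.Re (z sx) + (M j)%:R * (2 * pi * \sum_(i < d) `|complex.Im (z (inl i))|).
Proof.
move=> sg1; rewrite /lin big_sumType /= ReD addrC; apply: lerD.
  rewrite (bigD1 ord_max) //= eqxx big1 ?addr0 ?ReZ //.
  by move=> i /negPf ->; rewrite mul0r.
rewrite Re_sum !mulr_sumr; apply: ler_sum => i _.
rewrite [leLHS](_ : _ = - (sg * (2 * pi * (k j i)%:~R) * complex.Im (z (inl i)))); last first.
  by rewrite ReM /=; ring.
apply: le_trans (ler_norm _) _.
rewrite normrN !normrM sg1 mul1r mulrA mulrA ler_wpM2r //.
rewrite (ger0_norm (pi_ge0 R)) (ger0_norm (ler0n R 2)) -[_ * 2 * pi]mulrA [leRHS]mulrC.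
by rewrite ler_wpM2l ?mulr_ge0 ?pi_ge0 // norm_k.
Qed.

(** Separates what is linear in M_j, hence absorbed by the arbitrary [K] of [adm], from the part
    governed by [mu j] and Re s. *)
Lemma freq_exponent (sg : R) mu z (rho K : R) : `|sg| = 1 -> mu_ok mu -> 0 <= rho ->
  exists K', forall j,
    complex.Re (lin (freq sg mu j) z) + rho * lnorm (freq sg mu j) + K * (M j)%:R <=
    K' * (M j)%:R + mu j * (complex.Re (z sx) + rho).
Proof.
move=> sg1 muok rho0.
exists (2 * pi * (\sum_(i < d) `|complex.Im (z (inl i))|) + rho * (d%:R * (2 * pi)) + K).
move=> j; have /andP[mu0 _] := muok j.
have h1 := Re_lin_freq mu j z sg1.
have h2 := ler_wpM2l rho0 (lnorm_freq sg1 mu0).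
move: h1 h2; set A := complex.Re (lin _ _); set B := lnorm _; set S := \sum_(_ < _) _.
by set m := (M j)%:R; lra.
Qed.

Lemma tadm_of mu c z : (forall sg (c' : nat -> C), `|sg| = 1 ->
  (forall j, cabs (c' j) = cabs (c j)) -> adm MR (freq sg mu) c' z) -> tadm mu c z.
Proof.
move=> h; split; apply: h => //; rewrite ?normrN ?normr1 //.
by move=> j; rewrite /conjs cabs_conj.
Qed.

Lemma tadm_fin mu c z N : (forall j, (N <= j)%N -> c j = 0) -> tadm mu c z.
Proof.
move=> c0; apply: tadm_of => sg c' _ hc; exists 1 => // K.
pose a j := cabs (c' j) *
  expR (complex.Re (lin (freq sg mu j) z) + 1 * lnorm (freq sg mu j) + K * (M j)%:R).
have a0 j : 0 <= a j by rewrite /a mulr_ge0 ?cabs_ge0 ?expR_ge0.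
exists (\sum_(j < N) a j * 2 ^+ j) => j; rewrite -/(a j) exprVn ler_pdivlMr ?exprn_gt0 //.
have s0 i : 0 <= a i * 2 ^+ i by rewrite mulr_ge0 ?exprn_ge0.
case: (ltnP j N) => jN; first by rewrite (bigD1 (Ordinal jN)) //= lerDl sumr_ge0.
have -> : a j = 0 by rewrite /a hc c0 // cabs0 mul0r.
by rewrite mul0r sumr_ge0.
Qed.

Lemma tadm_decay c z : (exists K, forall j, cabs (c j) <= expR (K * (M j)%:R)) ->
  complex.Re (z sx) < 0 -> tadm mexp c z.
Proof.
move=> [K0 hc] z0; apply: tadm_of => sg c' sg1 hc'.
(* Half the distance to Re s = 0, so that Re s + rho = -rho. *)
pose rho := - complex.Re (z sx) / 2; have rho0 : 0 < rho by rewrite divr_gt0 ?oppr_gt0.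
exists rho => // K.
have [||K' hK'] := @freq_exponent sg mexp z rho K sg1; [|exact: ltW|].
  by move=> j; rewrite lexx andbT /mexp.
have [D hD] := decay_geo M2 (K0 + K') rho0.
exists D => j; apply: le_trans (hD j); rewrite hc'.
apply: le_trans (ler_pM (cabs_ge0 _) (expR_ge0 _) (hc j) (_ : _ <= expR _)) _; first by rewrite ler_expR; exact: hK'.
rewrite -expRD ler_expR -/(mexp j) [X in _ + (_ + _ * X)](_ : _ = - rho); last by rewrite /rho; field.
by rewrite le_eqVlt; apply/orP; left; apply/eqP; ring.
Qed.

Hypothesis e_small : forall j, `|e j| <= expR (- ((j.+1 ^ 2)%N%:R * (M j)%:R)).

Lemma tadm_small c z : (exists K, forall j, cabs (c j) <= `|e j| * expR (K * (M j)%:R)) ->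
  tadm mexp c z.
Proof.
move=> [K0 hc]; apply: tadm_of => sg c' sg1 hc'; exists 1 => // K.
have [||K' hK'] := @freq_exponent sg mexp z 1 K sg1; [|by []|].
  by move=> j; rewrite lexx andbT /mexp.
have [D hD] := small_geo M2 e_small (complex.Re (z sx) + 1) (K0 + K').
exists D => j; apply: le_trans (hD j); rewrite hc'.
apply: le_trans (ler_pM (cabs_ge0 _) (expR_ge0 _) (hc j) (_ : _ <= expR _)) _; first by rewrite ler_expR; exact: hK'.
rewrite -mulrA -expRD ler_wpM2l // ler_expR -/(mexp j).
by rewrite le_eqVlt; apply/orP; left; apply/eqP; ring.
Qed.

Lemma tadm_mul mu c z a : tadm mu c z -> moderate MR a -> tadm mu (fun j => a j * c j) z.
Proof.
move=> [h1 h2] [K hK]; split; first by apply: adm_mul => //; exists K.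
by rewrite conjs_mul; apply: adm_mul => //; exists K => j; rewrite cabs_conj.
Qed.

Definition trig_grad nu mu c z : ptT C d := fun x => match x with
  | inl i => trig nu mu (fun j => freq 1 mu j (inl i) * c j) z
  | inr i => if i == ord_max then
      trig nu mu (fun j => ((mu j)%:C)%C * c j) z +
      trig (fun j => (nu j).-1) mu (fun j => (nu j)%:R * c j) z else 0
  end.

Lemma fam0 nu la z : fam sx nu la (fun=> 0) z = 0.
Proof.
rewrite /fam -[RHS](csum0 R); congr csum; apply/funext => j.
by rewrite /fterm !mul0r.
Qed.

Lemma trig_quad_diff nu mu c z : mu_ok mu -> nu_ok nu -> tadm mu c z ->
  quad_diff (trig nu mu c) z (trig_grad nu mu c z).
Proof.
move=> muok nuok [h1 h2].
have n1 : `|(-1 : R)| = 1 by rewrite normrN normr1.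
have t1 := freq_tame (normr1 R) muok nuok.
have t2 := freq_tame n1 muok nuok.
apply: quad_diff_grad (quad_diffD (fam_quad_diff sx t1 h1) (fam_quad_diff sx t2 h2)) _.
have cr (a : nat -> R) : conjs (fun j => ((a j)%:C)%C * c j) = (fun j => ((a j)%:C)%C * conjs c j).
  by apply/funext => j; rewrite /conjs; case: (c j) => x y; apply: ceqP => /=; ring.
have cn : conjs (fun j => (nu j)%:R * c j) = (fun j => (nu j)%:R * conjs c j).
  have := cr (fun j => (nu j)%:R).
  by under eq_fun do rewrite (rmorph_nat (real_complex R)); under [in RHS]eq_fun do rewrite (rmorph_nat (real_complex R)).
move=> [i|i]; rewrite /fam_grad /trig_grad /trig.
  have -> : ((inl i : 'I_d + 'I_d)%type == sx) = false by [].
  have -> : conjs (fun j => freq 1 mu j (inl i) * c j) = (fun j => freq (-1) mu j (inl i) * conjs c j).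
    by apply/funext => j; rewrite freq_conj /conjs rmorphM.
  by rewrite [X in _ + X * _ + _]/(0 : C) [X in _ + (_ + X * _)]/(0 : C) !mul0r !addr0.
have [->|ne] := eqVneq i ord_max.
  by rewrite /freq !eqxx cn cr !mul1r addrACA.
have -> : ((inr i : 'I_d + 'I_d)%type == sx) = false by apply/negbTE/eqP => -[] /eqP; rewrite (negPf ne).
rewrite [X in _ + X * _ + _]/(0 : C) [X in _ + (_ + X * _)]/(0 : C) !mul0r !addr0 /freq (negPf ne).
have z0 (a : nat -> C) : (fun j => 0 * a j) = (fun=> 0) by apply/funext => j; rewrite mul0r.
by rewrite (z0 c) (z0 (conjs c)) !fam0 addr0.
Qed.

Lemma famD nu la c c' z : tame MR nu la -> adm MR la c z -> adm MR la c' z ->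
  fam sx nu la (fun j => c j + c' j) z = fam sx nu la c z + fam sx nu la c' z.
Proof.
move=> t h h'; rewrite /fam -csumD; do ?exact: (fterm_cgeo0 sx t).
by congr csum; apply/funext => j; rewrite /fterm; ring.
Qed.

Lemma famZ nu la c z (a : C) : tame MR nu la -> adm MR la c z ->
  fam sx nu la (fun j => a * c j) z = a * fam sx nu la c z.
Proof.
move=> t h; rewrite /fam -csumZ; last exact: (fterm_cgeo0 sx t).
by congr csum; apply/funext => j; rewrite /fterm; ring.
Qed.

Lemma trigD nu mu c c' z : mu_ok mu -> nu_ok nu -> tadm mu c z -> tadm mu c' z ->
  trig nu mu (fun j => c j + c' j) z = trig nu mu c z + trig nu mu c' z.
Proof.
move=> muok nuok [h1 h2] [h1' h2'].
have n1 : `|(-1 : R)| = 1 by rewrite normrN normr1.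
have t1 := freq_tame (normr1 R) muok nuok.
have t2 := freq_tame n1 muok nuok.
rewrite /trig; have -> : conjs (fun j => c j + c' j) = (fun j => conjs c j + conjs c' j).
  by apply/funext => j; rewrite /conjs rmorphD.
by rewrite !(famD t1, famD t2) // addrACA.
Qed.

Lemma trigZ nu mu c z (a : R) : mu_ok mu -> nu_ok nu -> tadm mu c z ->
  trig nu mu (fun j => (a%:C)%C * c j) z = (a%:C)%C * trig nu mu c z.
Proof.
move=> muok nuok [h1 h2].
have n1 : `|(-1 : R)| = 1 by rewrite normrN normr1.
have t1 := freq_tame (normr1 R) muok nuok.
have t2 := freq_tame n1 muok nuok.
rewrite /trig; have -> : conjs (fun j => (a%:C)%C * c j) = (fun j => (a%:C)%C * conjs c j).
  by apply/funext => j; rewrite /conjs; case: (c j) => x y; apply: ceqP => /=; ring.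
by rewrite !(famZ _ t1, famZ _ t2) // mulrDr.
Qed.

Lemma eq_trig nu mu c c' z : c =1 c' -> trig nu mu c z = trig nu mu c' z.
Proof. by move=> /funext ->. Qed.

Lemma trig0 nu mu z : trig nu mu (fun=> 0) z = 0.
Proof.
rewrite /trig fam0 add0r (_ : conjs _ = fun=> 0) ?fam0 //.
by apply/funext => j; rewrite /conjs rmorph0.
Qed.

Definition phase (th : 'I_d -> R) j : R := 2 * pi * \sum_(i < d) (k j i)%:~R * th i.

Lemma lin_freq_real (sg : R) mu j p : lin (freq sg mu j) (cplx p) =
  (mu j * p sx +i* (sg * phase (ang p) j))%C.
Proof.
rewrite /lin big_sumType /=; apply: ceqP; rewrite ?ReD ?ImD /=.
  rewrite Re_sum big1 ?add0r; last by move=> i _; rewrite ReM /=; ring.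
  rewrite (bigD1 ord_max) //= eqxx big1 ?addr0 ?ReZ //.
  by move=> i /negPf ->; rewrite mul0r.
have -> : complex.Im (\sum_(i < d) (if i == ord_max then (mu j)%:C%C else 0) * cplx p (inr i)) = 0.
  rewrite (bigD1 ord_max) //= eqxx big1 ?addr0; last by move=> i /negPf ->; rewrite mul0r.
  by rewrite ImZ /= mulr0.
rewrite addr0 (big_morph (@complex.Im R) (@ImD R) erefl) /phase !mulr_sumr; apply: eq_bigr => i _.
by rewrite ImM /= /ang; ring.
Qed.

Definition rterm (m : nat) (u : R) (a : C) (ph s : R) : R :=
  2 * (s ^+ m * expR (u * s) * (complex.Re a * cos ph - complex.Im a * sin ph)).

Lemma cplx_expn (x : R) m : ((x%:C)%C ^+ m : C) = ((x ^+ m)%:C)%C.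
Proof. by rewrite rmorphXn. Qed.

Lemma fterm_real nu mu c p j :
  fterm sx (nu j) (freq 1 mu j) (c j) (cplx p) +
  fterm sx (nu j) (freq (-1) mu j) (conjs c j) (cplx p) =
  ((rterm (nu j) (mu j) (c j) (phase (ang p) j) (p sx))%:C)%C.
Proof.
rewrite /fterm !lin_freq_real mul1r mulN1r /cexp /= cosN sinN /cplx cplx_expn /conjs.
rewrite /rterm; case: (c j) => a b; apply: ceqP => /=; ring.
Qed.

Lemma trig_real nu mu c p : mu_ok mu -> nu_ok nu -> tadm mu c (cplx p) ->
  geo (fun j => rterm (nu j) (mu j) (c j) (phase (ang p) j) (p sx)) /\
  trig nu mu c (cplx p) =
  ((rsum (fun j => rterm (nu j) (mu j) (c j) (phase (ang p) j) (p sx)))%:C)%C.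
Proof.
move=> muok nuok [h1 h2].
have n1 : `|(-1 : R)| = 1 by rewrite normrN normr1.
have g1 := fterm_cgeo0 sx (freq_tame (normr1 R) muok nuok) h1.
have g2 := fterm_cgeo0 sx (freq_tame n1 muok nuok) h2.
have eF : (fun j => fterm sx (nu j) (freq 1 mu j) (c j) (cplx p) +
    fterm sx (nu j) (freq (-1) mu j) (conjs c j) (cplx p)) =
  (fun j => ((rterm (nu j) (mu j) (c j) (phase (ang p) j) (p sx))%:C)%C).
  by apply/funext => j; rewrite fterm_real.
have g : cgeo (fun j => ((rterm (nu j) (mu j) (c j) (phase (ang p) j) (p sx))%:C)%C).
  by rewrite -eF; exact: cgeoD.
split; first exact: cgeo_Re g.
rewrite /trig /fam -csumD // eF; apply: ceqP => /=; first by [].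
exact: rsum0.
Qed.

Lemma trig_cplx nu mu c p : mu_ok mu -> nu_ok nu -> tadm mu c (cplx p) ->
  trig nu mu c (cplx p) = ((complex.Re (trig nu mu c (cplx p)))%:C)%C.
Proof. by move=> muok nuok h; have [_ ->] := trig_real muok nuok h. Qed.

Lemma trig_ext nu mu c z z' : (forall i, i != ord_max -> z (inl i) = z' (inl i)) ->
  (forall j, k j ord_max = 0) -> z sx = z' sx -> trig nu mu c z = trig nu mu c z'.
Proof.
move=> hz k0 hs; have L (sg : R) j : lin (freq sg mu j) z = lin (freq sg mu j) z'.
  apply: eq_bigr => -[i|i] _ /=; last by case: eqP => [->|_]; rewrite ?hs ?mul0r.
  have [->|ne] := eqVneq i ord_max; first by rewrite k0 !mulr0 !mul0r.
  by rewrite hz.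
by rewrite /trig /fam; congr (csum _ + csum _); apply/funext => j; rewrite /fterm L hs.
Qed.

Lemma trig_transl nu mu c z (q : 'I_d -> int) : trig nu mu c (transl z q) = trig nu mu c z.
Proof.
have L (sg : R) j : sg = 1 \/ sg = -1 ->
    cexp (lin (freq sg mu j) (transl z q)) = cexp (lin (freq sg mu j) z).
  move=> hsg; pose N : int := (if sg == 1 then 1 else -1) * \sum_(i < d) k j i * q i.
  have -> : lin (freq sg mu j) (transl z q) =
      lin (freq sg mu j) z + ((N%:~R * (2 * pi))%:C * 'i)%C.
    rewrite /lin !big_sumType /= [RHS]addrAC; congr (_ + _).
    under eq_bigr do rewrite mulrDr.
    rewrite big_split /=; congr (_ + _).
    rewrite /N intrM (_ : ((if sg == 1 then 1 else -1) : int)%:~R = sg); last first.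
      case: hsg => ->; first by rewrite eqxx.
      by rewrite (_ : (-1 == 1 :> R) = false) //; apply/negbTE/eqP; lra.
    rewrite (raddf_sum (intmul 1 : {additive int -> R})) /= mulr_sumr mulr_suml.
    rewrite (raddf_sum (real_complex R)) /= mulr_suml; apply: eq_bigr => i _.
    have -> : ((q i)%:~R : C) = (((q i)%:~R : R)%:C)%C by rewrite rmorph_int.
    by rewrite intrM; apply: ceqP => /=; ring.
  by rewrite cexpD cexp_int mulr1.
rewrite /trig /fam; congr (csum _ + csum _); apply/funext => j;
  by rewrite /fterm L /=; auto.
Qed.

End TrigFamily.

Arguments freq : simpl never.
Arguments trig : simpl never.
Arguments trig_grad : simpl never.
Arguments phase : simpl never.
Arguments mexp : simpl never.

(** * The Hamiltonian and the conjugacy *)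

Section SymplAlgebra.
Variables (R : realType) (d : nat).
Implicit Types u v : ptT R d.

(** [P], [Q], [S] stand for the second derivatives of f in (theta, theta), (theta, s) and (s, s),
    and [m] is the last index. The [Q] terms of angle and action parts cancel; what is left is
    symmetric in u and v and drops out of the antisymmetric form. *)
Lemma sympl_shear (m : 'I_d) (P : 'I_d -> 'I_d -> R) (Q : 'I_d -> R) (S : R)
    (D : ptT R d -> ptT R d) u v :
  (forall i l, P i l = P l i) -> (forall l, P m l = 0) -> Q m = 0 ->
  (forall u i, D u (inl i) = u (inl i) -
     (if i == m then \sum_l Q l * u (inl l) + S * u (inr m) else 0)) ->
  (forall u i, D u (inr i) = u (inr i) + (\sum_l P i l * u (inl l) + Q i * u (inr m))) ->
  sympl (D u) (D v) = sympl u v.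
Proof.
move=> Ps P0 Q0 Dl Dr.
pose T (u v : ptT R d) := \sum_i u (inl i) * v (inr i).
pose q (u : ptT R d) := \sum_l Q l * u (inl l).
have TD u' v' : T (D u') (D v') =
    T u' v' + \sum_i \sum_l P i l * u' (inl i) * v' (inl l) - S * u' (inr m) * v' (inr m).
  rewrite /T (eq_bigr (fun i => u' (inl i) * v' (inr i) +
      \sum_l P i l * u' (inl i) * v' (inl l) + Q i * u' (inl i) * v' (inr m)
      - (if i == m then (q u' + S * u' (inr m)) * v' (inr m) else 0))); last first.
    move=> i _; rewrite Dl Dr.
    have [->|_] := eqVneq i m.
      rewrite [X in _ * (_ + (X + _))]big1 => [|l _]; last by rewrite P0 mul0r.
      rewrite [X in _ = _ + X + _ - _]big1 => [|l _]; last by rewrite P0 !mul0r.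
      by rewrite Q0 -/(q u'); ring.
    rewrite !subr0 mulrDr mulrDr mulr_sumr addrA; congr (_ + _ + _); last by ring.
    by apply: eq_bigr => l _; ring.
  rewrite sumrB !big_split /= -big_mkcond big_pred1_eq /q -mulr_suml; ring.
have e u' v' : sympl u' v' = T u' v' - T v' u'.
  by rewrite /sympl /T -sumrB; apply: eq_bigr => i _; ring.
rewrite !e !TD.
have -> : \sum_i \sum_l P i l * u (inl i) * v (inl l) = \sum_i \sum_l P i l * v (inl i) * u (inl l).
  rewrite exchange_big; apply: eq_bigr => i _; apply: eq_bigr => l _.
  by rewrite Ps; ring.
ring.
Qed.

End SymplAlgebra.

Section Construction.
Variables (R : realType) (n : nat).
Local Notation C := R[i].
Local Notation d := n.+1.
Variables (w : 'I_d -> R) (k : nat -> 'I_d -> int) (M : nat -> nat).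
Definition small_div j : R := \sum_i w i * (k j i)%:~R.
Local Notation e := small_div.
Hypothesis M2 : forall j, (j.+1 ^ 2 <= M j)%N.
Hypothesis kM : forall j i, (`|k j i| <= M j)%N.
Hypothesis k0 : forall j, k j ord_max = 0.
Hypothesis e_small : forall j, `|e j| <= expR (- ((j.+1 ^ 2)%N%:R * (M j)%:R)).
Implicit Types (z : ptT C d) (p : ptT R d).

Local Notation MR := (fun j => (M j)%:R : R).
Local Notation sx := (inr ord_max : 'I_d + 'I_d)%type.
Local Notation mu := (mexp R M).
Local Notation nu := (fun j : nat => j.+2).
Local Notation nu' := (fun j : nat => j.+1).
Local Notation fr i := (fun j => freq k 1 mu j (inl i)).
Local Notation mc := (fun j => ((mu j)%:C)%C).
Local Notation Tr := (trig k).

Lemma mexp_ok : mu_ok M mu.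
Proof. by move=> j; rewrite lexx andbT /mexp. Qed.
Lemma zero_ok : mu_ok M (fun=> 0 : R).
Proof. by move=> j; rewrite lexx /= /mexp. Qed.
Lemma nu_ok_S2 : nu_ok nu. Proof. by move=> j. Qed.
Lemma nu_ok_S1 : nu_ok nu'. Proof. by move=> j. Qed.

Lemma mexp_tame : tame MR nu (freq k 1 mu).
Proof. exact: freq_tame M2 kM _ _ _ (normr1 R) mexp_ok nu_ok_S2. Qed.

Lemma freq_moderate i : moderate MR (fr i).
Proof. exact: moderate_freq mexp_tame. Qed.

Lemma nu_moderate : moderate MR (fun j => (nu j)%:R : C).
Proof. exact: moderate_nu mexp_tame. Qed.

Lemma cst_moderate (a : R) : moderate MR (fun=> (a%:C)%C).
Proof.
exists `|a| => j; rewrite cabs_real.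
apply: (@le_trans _ _ (1 + `|a| * (M j)%:R)); last exact: expR_ge1Dx.
by rewrite (le_trans (_ : `|a| <= `|a| * (M j)%:R)) ?lerDr // ler_peMr // M_ge1.
Qed.

(** Moves a pairing with omega inside the series, where the factors omega_i k_i recombine into the
    divisor e_j. *)
Lemma trig_sum (J : Type) (r : seq J) nu1 mu1 (a : J -> R) (c : J -> nat -> C) z :
  mu_ok M mu1 -> nu_ok nu1 -> (forall i, tadm k M mu1 (c i) z) ->
  tadm k M mu1 (fun j => \sum_(i <- r) ((a i)%:C)%C * c i j) z /\
  \sum_(i <- r) ((a i)%:C)%C * Tr nu1 mu1 (c i) z =
  Tr nu1 mu1 (fun j => \sum_(i <- r) ((a i)%:C)%C * c i j) z.
Proof.
move=> muok nuok hc; elim: r => [|i r [IH1 IH2]].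
  rewrite (_ : (fun j => _) = (fun=> 0)); last by apply/funext => j; rewrite big_nil.
  by rewrite trig0 big_nil; split => //; exact: (@tadm_fin _ _ _ _ _ _ _ 0%N).
have a1 : tadm k M mu1 (fun j => ((a i)%:C)%C * c i j) z.
  exact: tadm_mul (cst_moderate _).
have -> : (fun j => \sum_(i <- i :: r) ((a i)%:C)%C * c i j) =
    (fun j => ((a i)%:C)%C * c i j + \sum_(i <- r) ((a i)%:C)%C * c i j).
  by apply/funext => j; rewrite big_cons.
split; last by rewrite (trigD M2 kM) // big_cons IH2 (trigZ M2 kM).
case: a1 IH1 => h1 h2 [h3 h4]; split; first exact: adm_add h1 h3.
rewrite (_ : conjs _ = (fun j => conjs (fun j => ((a i)%:C)%C * c i j) j +
    conjs (fun j => \sum_(i <- r) ((a i)%:C)%C * c i j) j)); first exact: adm_add h2 h4.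
by apply/funext => j; rewrite /conjs rmorphD.
Qed.

Lemma mexp_moderate : moderate MR mc.
Proof.
exists 2 => j; rewrite cabs_real ger0_norm /mexp // natrM.
have h : (M j)%:R <= expR (M j)%:R :> R.
  by apply: le_trans (expR_ge1Dx _); rewrite lerDr.
rewrite [2 * _]mulr_natl mulr2n expRD ler_pM //.
by apply: le_trans h; rewrite ler_nat M_gt.
Qed.

(** Half of e_j, because [trig] adds the conjugate exponential. *)
Definition cH (j : nat) : C := ((e j / 2)%:C)%C.

Lemma cH_adm z : tadm k M mu cH z.
Proof.
apply: (tadm_small M2 kM e_small); exists 0 => j.
by rewrite mul0r expR0 mulr1 cabs_real normrM normfV (ger0_norm (ler0n R 2)) ler_piMr // invf_le1 // ler1n.
Qed.

Definition wl : ptT C d := fun x => if x is inr i then ((w i)%:C)%C else 0.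
Definition Hc z : C := \sum_x wl x * z x + Tr nu mu cH z.
Definition Hr p : R := complex.Re (Hc (cplx p)).

Lemma wl_real p : \sum_x wl x * cplx p x = ((pairing w (act p))%:C)%C.
Proof.
rewrite big_sumType /= big1 ?add0r => [|i _]; last by rewrite mul0r.
rewrite /pairing (raddf_sum (real_complex R)); apply: eq_bigr => i _.
by rewrite -rmorphM.
Qed.

Lemma Hc_real p : Hc (cplx p) = ((Hr p)%:C)%C.
Proof.
rewrite /Hr /Hc wl_real (trig_cplx M2 kM mexp_ok nu_ok_S2 (cH_adm _)).
by rewrite -rmorphD.
Qed.

Lemma HrE p : Hr p = pairing w (act p) + complex.Re (Tr nu mu cH (cplx p)).
Proof. by rewrite /Hr /Hc wl_real ReD. Qed.

Definition Hgrad z x := wl x + trig_grad k nu mu cH z x.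

Lemma Hc_quad_diff z : quad_diff Hc z (Hgrad z).
Proof.
exact: quad_diffD (quad_diff_linear _ _)
  (trig_quad_diff M2 kM mexp_ok nu_ok_S2 (cH_adm z)).
Qed.

Lemma Hr_entire : real_entire_ham Hr.
Proof.
exists Hc; split; [|split] => [|z q|p].
- by apply: quad_diff_holo => z _; exists (Hgrad z); exact: Hc_quad_diff.
- rewrite /Hc trig_transl; congr (_ + _).
  by rewrite !big_sumType /=; congr (_ + _); apply: eq_bigr => i _; rewrite !mul0r.
- exact: Hc_real.
Qed.

Definition amp (j : nat) (s : R) : R := s ^+ j.+2 * expR (mu j * s).

Lemma amp_norm j s : `|amp j s| <= `|s| ^+ j.+2 * expR (mu j * `|s|).
Proof.
rewrite /amp normrM normrX (ger0_norm (expR_ge0 _)) ler_wpM2l ?exprn_ge0 //.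
by rewrite ler_expR ler_wpM2l ?ler_norm // /mexp.
Qed.

Lemma Hr_sum p : geo (fun j => e j * amp j (p sx) * cos (phase k (ang p) j)) /\
  Hr p = pairing w (act p) + rsum (fun j => e j * amp j (p sx) * cos (phase k (ang p) j)).
Proof.
have [g h] := trig_real M2 kM mexp_ok nu_ok_S2 (cH_adm (cplx p)).
have E : (fun j => rterm (nu j) (mu j) (cH j) (phase k (ang p) j) (p sx)) =
    (fun j => e j * amp j (p sx) * cos (phase k (ang p) j)).
  by apply/funext => j; rewrite /rterm /amp /cH /=; field.
by rewrite HrE h /= -E.
Qed.

Lemma small_div_sum (S K : R) : exists D, forall j,
  `|e j| * expR (K * (M j)%:R + S * mu j) <= D * 2^-1 ^+ j.
Proof. exact: small_geo. Qed.

Lemma Hr_form : ham_form w Hr.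
Proof.
have [D hD] := small_div_sum 1 0.
have D0 : 0 <= D.
  have := hD 0%N; rewrite expr0 mulr1; apply: le_trans.
  by rewrite mulr_ge0 ?expR_ge0.
exists (2 * D + 1); first by rewrite ltr_wpDl // mulr_ge0.
exists 1 => // p hp; have [g ->] := Hr_sum p; rewrite addrC addKr.
set s := p sx; have s1 : `|s| <= 1 by exact: hp.
(* For |s| <= 1 the power s^(j+2) is at most s^2 in modulus and the exponential at most exp(m_j);
   the divisors make this summable. *)
have B : `|rsum (fun j => e j * amp j s * cos (phase k (ang p) j))| <= 2 * (D * s ^+ 2).
  apply: rsum_le => j.
  have h1 : `|e j * amp j s * cos (phase k (ang p) j)| <= `|e j| * `|amp j s|.
    by rewrite normrM normrM ler_piMr ?mulr_ge0 ?cos_max.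
  have h2 : `|amp j s| <= expR (0 * (M j)%:R + 1 * mu j) * s ^+ 2.
    rewrite mul0r add0r mul1r; apply: le_trans (amp_norm _ _) _.
    rewrite mulrC ler_pM ?expR_ge0 ?exprn_ge0 //.
      by rewrite ler_expR ler_piMr // /mexp.
    rewrite -[s ^+ 2]ger0_norm ?sqr_ge0 // normrX.
    by rewrite 2!exprS mulrA -expr2 ler_piMr ?exprn_ge0 // exprn_ile1.
  apply: le_trans h1 (le_trans (ler_wpM2l (normr_ge0 _) h2) _).
  by rewrite mulrA [D * _ * _]mulrAC ler_wpM2r ?sqr_ge0.
apply: le_trans B _; have s2 : s ^+ 2 <= \sum_(i < d) act p i ^+ 2.
  by rewrite (bigD1 ord_max) //= lerDl sumr_ge0 // => i _; exact: sqr_ge0.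
have : 0 <= s ^+ 2 by exact: sqr_ge0.
by move: s2; set a := s ^+ 2; set b := \sum_(_ < _) _ => *; nra.
Qed.

(* The coefficient sequence of the generating function
   eps * sum_j - amp_j(s) / (2 pi) * sin (2 pi <k_j, theta>). *)
Definition cF (eps : R) (j : nat) : C := ((eps / (4 * pi))%:C * 'i)%C.

Lemma cF_adm eps z : complex.Re (z sx) < 0 -> tadm k M mu (cF eps) z.
Proof.
apply: (tadm_decay M2 kM).
have [K hK] := cst_moderate (eps / (4 * pi)); exists K => j.
by apply: le_trans (hK j); rewrite /cF cabsM cabs_i mulr1.
Qed.

Lemma cF_adm_mul eps a z : moderate MR a -> complex.Re (z sx) < 0 ->
  tadm k M mu (fun j => a j * cF eps j) z.
Proof. by move=> ma z0; apply: tadm_mul => //; exact: cF_adm. Qed.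

Definition Fth eps i z : C := Tr nu mu (fun j => fr i j * cF eps j) z.
Definition Fs eps z : C := Tr nu mu (fun j => mc j * cF eps j) z +
  Tr nu' mu (fun j => (nu j)%:R * cF eps j) z.

Arguments cF : simpl never.
Arguments Fth : simpl never.
Arguments Fs : simpl never.

Definition PsiC eps z : ptT C d := fun y => match y with
  | inl i => z (inl i) + (-1) * (if i == ord_max then Fs eps z else 0)
  | inr i => z (inr i) + Fth eps i z
  end.
(** This is the time-[eps] map of the Hamiltonian -f (f taken at [eps = 1]): f depends only on
    coordinates that its own flow fixes, so the flow is affine in time. *)
Definition Psi eps p : ptT R d := fun y => complex.Re (PsiC eps (cplx p) y).

Definition PsiG eps z y : ptT C d := match y with
  | inl i => fun x => (x == inl i)%:R + (-1) * (if i == ord_max then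
      trig_grad k nu mu (fun j => mc j * cF eps j) z x +
      trig_grad k nu' mu (fun j => (nu j)%:R * cF eps j) z x else 0)
  | inr i => fun x => (x == inr i)%:R + trig_grad k nu mu (fun j => fr i j * cF eps j) z x
  end.

Lemma quad_diff0 z : quad_diff (fun=> 0 : C) z (fun=> 0).
Proof.
have := quad_diff_linear (fun=> 0) z.
rewrite (_ : (fun z0 : ptT C d => _) = (fun=> 0)) //.
by apply/funext => z'; rewrite big1 // => x _; rewrite mul0r.
Qed.

Lemma PsiC_quad_diff eps z y : complex.Re (z sx) < 0 ->
  quad_diff (fun z => PsiC eps z y) z (PsiG eps z y).
Proof.
move=> z0; case: y => i /=; apply: quad_diffD (quad_diff_coord _ _) _; last first.
  have h := trig_quad_diff M2 kM mexp_ok nu_ok_S2 (cF_adm_mul eps (freq_moderate i) z0).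
  exact: h.
apply: quad_diffZ; case: eqP => _; last exact: quad_diff0.
apply: quad_diffD.
  have h := trig_quad_diff M2 kM mexp_ok nu_ok_S2 (cF_adm_mul eps mexp_moderate z0).
  exact: h.
have h := trig_quad_diff M2 kM mexp_ok nu_ok_S1 (cF_adm_mul eps nu_moderate z0).
exact: h.
Qed.

Lemma Psi_analytic eps y : real_analytic_on (Mneg R d) (fun p => Psi eps p y).
Proof.
move=> p /(_ ord_max erefl) p0.
(* At this radius the complex polydisc stays inside Re s < 0, where the series converge. *)
exists (- p sx / 2); first by rewrite divr_gt0 // oppr_gt0.
have neg z : cclose (- p sx / 2) (cplx p) z -> complex.Re (z sx) < 0.
  move=> /(_ sx); rewrite norm_cabs ltcR => /(le_lt_trans (Re_le _)).
  rewrite ReD ReN /= ltr_norml => /andP[+ _]; lra.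
exists (fun z => PsiC eps z y); split.
  apply: quad_diff_holo => z /neg z0; exists (PsiG eps z y); exact: PsiC_quad_diff.
move=> x x0 _; rewrite /Psi; have {}x0 : x sx < 0 by exact: x0.
have r1 i : Fth eps i (cplx x) = ((complex.Re (Fth eps i (cplx x)))%:C)%C.
  have h := trig_cplx M2 kM mexp_ok nu_ok_S2 (cF_adm_mul eps (z := cplx x) (freq_moderate i) x0).
  exact: h.
have r2 : Fs eps (cplx x) = ((complex.Re (Fs eps (cplx x)))%:C)%C.
  rewrite /Fs.
  rewrite {1}(trig_cplx M2 kM mexp_ok nu_ok_S2 (cF_adm_mul _ (z := cplx x) mexp_moderate x0)).
  rewrite {1}(trig_cplx M2 kM mexp_ok nu_ok_S1 (cF_adm_mul _ (z := cplx x) nu_moderate x0)).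
  by rewrite ReD -(rmorphD (real_complex R)).
have i1 i : complex.Im (Fth eps i (cplx x)) = 0 by rewrite r1.
have i2 : complex.Im (Fs eps (cplx x)) = 0 by rewrite r2.
apply: ceqP; first by []; rewrite [RHS](_ : _ = 0) //.
case: y => i; rewrite /PsiC ImD; last by rewrite i1 addr0.
by rewrite mulN1r ImN; case: ifP => _; rewrite ?i2 oppr0 addr0.
Qed.

Lemma Psi_inr eps p i : Psi eps p (inr i) = p (inr i) + complex.Re (Fth eps i (cplx p)).
Proof. exact: ReD. Qed.

Lemma Psi_inl eps p i : Psi eps p (inl i) =
  p (inl i) - (if i == ord_max then complex.Re (Fs eps (cplx p)) else 0).
Proof.
rewrite /Psi /=; case: eqP => _; rewrite ?mulr0 ?addr0 ?subr0 //.
by rewrite mulN1r ReD ReN.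
Qed.

Lemma freq_max (c : nat -> C) : (fun j => fr ord_max j * c j) = (fun=> 0).
Proof.
apply/funext => j; rewrite /freq k0 (_ : (1 * _)%:C%C = 0) ?mul0r //.
by rewrite !mulr0.
Qed.

Lemma Psi_sx eps p : Psi eps p sx = p sx.
Proof. by rewrite Psi_inr /Fth freq_max trig0 addr0. Qed.

Lemma Psi_ang eps p i : i != ord_max -> Psi eps p (inl i) = p (inl i).
Proof. by move=> /negPf ne; rewrite Psi_inl ne subr0. Qed.

(** Because the displacement is unchanged along [Psi], the inverse is obtained by reversing the sign
    of [eps]. *)
Lemma trig_Psi eps p nu1 mu1 c : Tr nu1 mu1 c (cplx (Psi eps p)) = Tr nu1 mu1 c (cplx p).
Proof.
apply: trig_ext => // [i ne|]; rewrite /cplx; first by rewrite Psi_ang.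
by rewrite Psi_sx.
Qed.

Lemma Fth_Psi eps' eps i p : Fth eps' i (cplx (Psi eps p)) = Fth eps' i (cplx p).
Proof. exact: trig_Psi. Qed.

Lemma Fs_Psi eps' eps p : Fs eps' (cplx (Psi eps p)) = Fs eps' (cplx p).
Proof. by rewrite /Fs !trig_Psi. Qed.

Lemma Psi_neg eps p : Mneg R d p -> Mneg R d (Psi eps p).
Proof.
move=> hp i hi; have -> : i = ord_max by apply/val_inj.
by rewrite Psi_sx; exact: hp.
Qed.

Lemma cplxN1 : -1 = ((-1 : R)%:C)%C :> C.
Proof. by rewrite rmorphN1. Qed.

Lemma cF_N eps j : cF (- eps) j = - cF eps j.
Proof. by rewrite /cF mulNr; apply: ceqP => /=; ring. Qed.

Lemma Fth_N eps i z : complex.Re (z sx) < 0 -> Fth (- eps) i z = - Fth eps i z.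
Proof.
move=> z0; rewrite -[RHS]mulN1r cplxN1 /Fth.
rewrite -(trigZ M2 kM _ mexp_ok nu_ok_S2 (cF_adm_mul _ (freq_moderate i) z0)).
by apply: eq_trig => j; rewrite cF_N -cplxN1 mulN1r mulrN.
Qed.

Lemma Fs_N eps z : complex.Re (z sx) < 0 -> Fs (- eps) z = - Fs eps z.
Proof.
move=> z0; rewrite -[RHS]mulN1r cplxN1 /Fs mulrDr.
rewrite -(trigZ M2 kM _ mexp_ok nu_ok_S2 (cF_adm_mul _ mexp_moderate z0)).
rewrite -(trigZ M2 kM _ mexp_ok nu_ok_S1 (cF_adm_mul _ nu_moderate z0)).
rewrite (eq_trig k nu mu (c' := fun j => ((-1 : R)%:C)%C * (mc j * cF eps j))).
  by rewrite (eq_trig k nu' mu (c' := fun j => ((-1 : R)%:C)%C * ((nu j)%:R * cF eps j))) // => j;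
    rewrite cF_N -cplxN1 mulN1r mulrN.
by move=> j; rewrite cF_N -cplxN1 mulN1r mulrN.
Qed.

Lemma Psi_inv eps p : Mneg R d p -> Psi (- eps) (Psi eps p) = p.
Proof.
move=> hp; have p0 : complex.Re (cplx p sx) < 0 by exact: hp.
apply/funext => -[i|i]; last first.
  by rewrite Psi_inr Fth_Psi Fth_N // ReN Psi_inr addrK.
rewrite Psi_inl Psi_inl Fs_Psi Fs_N // ReN.
by case: ifP => _; rewrite ?opprK ?addrNK // !subr0.
Qed.

Lemma cplx_transl p (q : 'I_d -> int) : cplx (transl p q) = transl (cplx p) q.
Proof.
apply/funext => -[i|i] //=; rewrite /cplx /= rmorphD /=; congr (_ + _).
by rewrite rmorph_int.
Qed.

Lemma Psi_transl eps p (q : 'I_d -> int) : Psi eps (transl p q) = transl (Psi eps p) q.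
Proof.
have E := cplx_transl p q.
apply/funext => -[i|i]; last by rewrite Psi_inr E /Fth trig_transl -/(Fth _ _ _) /= Psi_inr.
by rewrite Psi_inl E /Fs !trig_transl -/(Fs _ _) /= Psi_inl addrAC.
Qed.

Lemma Psi_dmap eps p u y : Mneg R d p ->
  dmap (Psi eps) p u y = \sum_x complex.Re (PsiG eps (cplx p) y x) * u x.
Proof.
move=> hp; have p0 : complex.Re (cplx p sx) < 0 by exact: hp.
have := quad_diff_line u (PsiC_quad_diff eps y p0) => h.
rewrite /dmap derive1E.
rewrite (_ : (fun s : R => Psi eps (p + s *: u) y) =
  (fun s => complex.Re (PsiC eps (cplx (fun x => p x + s * u x)) y))) //.
by rewrite derive_val.
Qed.

Lemma Psi_sympl eps p u v : Mneg R d p ->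
  sympl (dmap (Psi eps) p u) (dmap (Psi eps) p v) = sympl u v.
Proof.
move=> hp; set z := cplx p.
pose P i l := complex.Re (Tr nu mu (fun j => fr l j * (fr i j * cF eps j)) z).
pose Q i := complex.Re (Tr nu mu (fun j => mc j * (fr i j * cF eps j)) z +
   Tr nu' mu (fun j => (nu j)%:R * (fr i j * cF eps j)) z).
pose S := complex.Re (trig_grad k nu mu (fun j => mc j * cF eps j) z sx +
  trig_grad k nu' mu (fun j => (nu j)%:R * cF eps j) z sx).
have mulCA (a b : nat -> C) : (fun j => a j * (b j * cF eps j)) = (fun j => b j * (a j * cF eps j)).
  by apply/funext => j; exact: mulrCA.
have sum1 (u' : ptT R d) y : \sum_x complex.Re ((x == y)%:R : C) * u' x = u' y.
  rewrite (bigD1 y) //= eqxx mul1r big1 ?addr0 // => x /negPf ->; exact: mul0r.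
have sumR (u' : ptT R d) (G : ptT C d) : (forall i, i != ord_max -> G (inr i) = 0) ->
    \sum_x complex.Re (G x) * u' x =
    \sum_l complex.Re (G (inl l)) * u' (inl l) + complex.Re (G sx) * u' sx.
  move=> G0; rewrite big_sumType /=; congr (_ + _).
  rewrite (bigD1 ord_max) //= big1 ?addr0 // => i ni.
  by rewrite G0 // mul0r.
apply: (@sympl_shear _ _ ord_max P Q S) => [i l|l|||].
- by rewrite /P (mulCA (fr l)).
- by rewrite /P (mulCA (fr l)) freq_max trig0.
- by rewrite /Q (mulCA mc) (mulCA (fun j => (nu j)%:R)) !freq_max !trig0 addr0.
- move=> u' i; rewrite Psi_dmap //=.
  under eq_bigr do rewrite ReD mulrDl.
  rewrite big_split /= sum1; congr (_ + _); case: eqP => _; last first.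
    by rewrite oppr0 big1 // => x _; rewrite mulr0 mul0r.
  under eq_bigr do rewrite mulN1r ReN mulNr.
  rewrite sumrN sumR; last by move=> l /negPf nl; rewrite /trig_grad nl addr0.
  congr (- (_ + _)); apply: eq_bigr => l _; congr (complex.Re _ * _).
  by rewrite /trig_grad (mulCA mc) (mulCA (fun j => (nu j)%:R)).
- move=> u' i; rewrite Psi_dmap //=.
  under eq_bigr do rewrite ReD mulrDl.
  rewrite big_split /= sum1; congr (_ + _).
  rewrite sumR; last by move=> l /negPf nl; rewrite /trig_grad nl.
  by rewrite /trig_grad eqxx.
Qed.

Lemma Psi_diffeo : analytic_sympl_diffeo_Mneg (Psi 1) (Psi (-1)).
Proof.
have st eps p q : sameT (Psi eps p) (Psi eps (transl p q)).
  by exists q; rewrite Psi_transl.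
have id (p : ptT R d) : sameT p p.
  by exists (fun=> 0); apply/funext => -[i|i] //=; rewrite addr0.
do 2!(split; first by move=> p q _; exact: st).
do 2!(split; first by move=> p; exact: Psi_neg).
split; first by move=> p hp; rewrite Psi_inv.
split; first by move=> p hp; rewrite -{1}[1]opprK Psi_inv.
by split; [|split] => [y|y|p u v]; [exact: Psi_analytic..|exact: Psi_sympl].
Qed.

(** The conjugacy is exact: the perturbation is invariant under [Psi], and <omega, r> gains <omega,
    d_theta f>, which is minus the perturbation. *)
Lemma Hr_Psi p : Mneg R d p -> Hr (Psi 1 p) = pairing w (act p).
Proof.
move=> hp; have p0 : complex.Re (cplx p sx) < 0 by exact: hp.
rewrite HrE trig_Psi.
have -> : pairing w (act (Psi 1 p)) =
   pairing w (act p) + complex.Re (\sum_i ((w i)%:C)%C * Fth 1 i (cplx p)).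
  rewrite /pairing Re_sum -big_split; apply: eq_bigr => i _.
  by rewrite /act Psi_inr mulrDr ReZ.
suff -> : \sum_i ((w i)%:C)%C * Fth 1 i (cplx p) = - Tr nu mu cH (cplx p).
  by rewrite ReN addrNK.
have [_ ->] := trig_sum (index_enum 'I_d) w mexp_ok nu_ok_S2
  (fun i => cF_adm_mul 1 (freq_moderate i) p0).
rewrite -mulN1r cplxN1 -(trigZ M2 kM _ mexp_ok nu_ok_S2 (cH_adm _)).
(* omega_i (2 pi i k_i) times i / (4 pi) is -omega_i k_i / 2 (the unindexed i is the imaginary
   unit), and the sum over the coordinates is -e_j / 2. *)
apply: eq_trig => j; rewrite /cH /small_div.
rewrite mulr_suml (raddf_sum (real_complex R)) mulr_sumr; apply: eq_bigr => i _.
have pi0 : pi != 0 :> R by rewrite gt_eqF // pi_gt0.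
rewrite /freq /cF; move: (@pi R) pi0 => q q0.
by apply: ceqP => /=; [field | ring].
Qed.

End Construction.

Arguments cF : simpl never.
Arguments Fth : simpl never.
Arguments Fs : simpl never.

(** * The flow *)

Section Waves.
Variable R : realType.

Lemma cos_shift_le (a x : R) : `|cos (a + x) - cos a| <= 2 * `|x|.
Proof.
have -> : cos (a + x) - cos a = cos a * (cos x - 1) - sin a * sin x by rewrite cosD; ring.
apply: le_trans (ler_normB _ _) _; rewrite !normrM mulr_natl mulr2n.
have := cos_sub1_le x; have := sin_le_norm x; have := cos_max a; have := sin_max a.
have := normr_ge0 (cos x - 1); have := normr_ge0 (sin x).
by have := normr_ge0 (cos a); have := normr_ge0 (sin a); nra.
Qed.

Lemma cos_shift_le2 (a x : R) : `|cos (a + x) - cos a + x * sin a| <= 2 * x ^+ 2.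
Proof.
have -> : cos (a + x) - cos a + x * sin a = cos a * (cos x - 1) - sin a * (sin x - x).
  by rewrite cosD; ring.
apply: le_trans (ler_normB _ _) _; rewrite !normrM mulr_natl mulr2n.
have -> : x ^+ 2 = `|x| ^+ 2 by rewrite -normrX ger0_norm // sqr_ge0.
have := cos_sub1_le2 x; have := sin_sub_le2 x; have := cos_max a; have := sin_max a.
have := normr_ge0 (cos x - 1); have := normr_ge0 (sin x - x).
by have := normr_ge0 (cos a); have := normr_ge0 (sin a); nra.
Qed.

Variables (b be tau : nat -> R).
Hypothesis b_geo : geo (fun j => b j * tau j).
(** The amplitudes b_j may grow without bound. Subtracting the value at t = 0 leaves terms of size
    at most 2 |b_j tau_j t|, so only b_j tau_j has to be summable. *)
Definition wave t : R := rsum (fun j => b j * (cos (be j + tau j * t) - cos (be j))).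

Lemma wave_geo t : geo (fun j => b j * (cos (be j + tau j * t) - cos (be j))).
Proof.
have [D hD] := b_geo; exists (D * (2 * `|t|)) => j.
rewrite normrM; apply: le_trans (ler_wpM2l (normr_ge0 _) (cos_shift_le _ _)) _.
rewrite normrM [X in X <= _](_ : _ = `|b j * tau j| * (2 * `|t|)); last by rewrite normrM; ring.
by rewrite mulrAC ler_wpM2r ?mulr_ge0.
Qed.

Lemma wave_speed_geo t : geo (fun j => - (b j * tau j * sin (be j + tau j * t))).
Proof.
have [D hD] := b_geo; exists D => j; rewrite normrN normrM; apply: le_trans (hD j).
by rewrite ler_piMr // sin_max.
Qed.

Hypothesis tau_bound : exists T, forall j, `|tau j| <= T.

Lemma wave_derive (t : R) :
  is_derive t 1 wave (rsum (fun j => - (b j * tau j * sin (be j + tau j * t)))).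
Proof.
have [[D hD] [T hT]] := (b_geo, tau_bound).
apply: (@quad_is_derive _ _ _ _ (2 * (D * (2 * T))) 1) => // h _.
have gs := wave_speed_geo t.
rewrite /wave -mulN1r -[rsum _ * h]mulrC -mulNr -!rsumZ //; do ?exact: wave_geo.
have gz := geoZ (- h) gs; have gw := geoZ (-1) (wave_geo t).
rewrite -rsumD //; last exact: wave_geo.
rewrite -rsumD //; last by apply: geoD => //; exact: wave_geo.
rewrite -mulrA; apply: rsum_le => j.
rewrite (_ : _ + _ = b j * (cos (be j + tau j * t + tau j * h) - cos (be j + tau j * t) +
   tau j * h * sin (be j + tau j * t))); last by rewrite -[be j + _ + _]addrA -mulrDr; ring.
rewrite normrM; apply: le_trans (ler_wpM2l (normr_ge0 _) (cos_shift_le2 _ _)) _.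
have -> : `|b j| * (2 * (tau j * h) ^+ 2) = `|b j * tau j| * (2 * `|tau j|) * h ^+ 2.
  have -> : (tau j * h) ^+ 2 = `|tau j| ^+ 2 * h ^+ 2.
    by rewrite exprMn -normrX (ger0_norm (sqr_ge0 (tau j))).
  by rewrite normrM; ring.
rewrite [leRHS]mulrAC ler_wpM2r ?sqr_ge0 //.
rewrite [D * _ * _]mulrAC; by apply: ler_pM => //; rewrite ?mulr_ge0 // ler_wpM2l.
Qed.

End Waves.

Section RealODE.
Variable R : realType.

(** Stands in for a uniqueness theorem: the equations of motion are triangular and can be integrated
    one component after another. *)
Lemma eq_of_derive (f g df : R -> R) : f 0 = g 0 ->
  (forall t : R, 0 <= t -> is_derive t 1 f (df t)) ->
  (forall t : R, 0 <= t -> is_derive t 1 g (df t)) ->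
  forall t : R, 0 <= t -> f t = g t.
Proof.
move=> fg hf hg t t0.
have hd (x : R) : 0 <= x -> is_derive x 1 (f - g) 0.
  move=> x0; have h1 := hf _ x0; have h2 := hg _ x0.
  by rewrite -(subrr (df x)); apply: is_deriveB.
have [||c _] := @MVT_segment R (f - g) (fun=> 0) 0 t t0.
- by move=> x; rewrite in_itv /= => /andP[x0 _]; apply: hd; exact: ltW.
- apply: derivable_within_continuous => x; rewrite in_itv /= => /andP[x0 _].
  by have [] := hd x x0.
rewrite mul0r => /eqP; rewrite subr_eq0 => /eqP h.
have {}h : f t - g t = f 0 - g 0 by exact: h.
by apply/eqP; rewrite -subr_eq0 h fg subrr.
Qed.

Lemma cos_int (N : int) : cos (N%:~R * (2 * pi)) = 1 :> R.
Proof.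
have := congr1 (@complex.Re R) (cexp_int R N).
rewrite (_ : ((N%:~R * (2 * pi))%:C * 'i)%C = (0 +i* (N%:~R * (2 * pi)))%C :> R[i]).
  by rewrite /cexp /= expR0 mul1r mul0r subr0.
by apply: ceqP => /=; ring.
Qed.

Lemma cos_hit1 (be a T : R) : a != 0 ->
  exists t, [/\ T <= t, t <= T + `|a|^-1 & cos (be + 2 * pi * a * t) = 1].
Proof.
wlog a0 : be a / 0 < a => [H an0|_].
  have [a0|a0|/eqP] := ltgtP a 0; [|exact: H|by rewrite (negPf an0)].
  have [||t [t1 t2 t3]] := H (- be) (- a); [by rewrite oppr_gt0|by rewrite oppr_eq0|].
  exists t; split => //; first by rewrite -normrN.
  by rewrite -cosN -[RHS]t3; congr cos; ring.
have pi0 : (2 * pi : R) != 0 by rewrite mulf_neq0 // gt_eqF // pi_gt0.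
(* [y] is the phase at time T in turns; the next integer [N] is reached within one period 1 /
   |a|. *)
pose y := be / (2 * pi) + a * T; pose N := (Num.floor y + 1)%R.
have /andP[h1 h2] := floor_itv y.
have d1 : 0 <= N%:~R - y by rewrite subr_ge0 ltW.
have d2 : N%:~R - y <= 1.
  by rewrite /N intrD lerBlDr addrC lerD2l.
exists (T + (N%:~R - y) / a); rewrite (gtr0_norm a0); split.
- by rewrite lerDl divr_ge0 // ltW.
- by rewrite lerD2l ler_pdivrMr // mulVf // gt_eqF.
rewrite -[RHS](cos_int N); congr cos.
have an : a != 0 by rewrite gt_eqF.
rewrite /y; move: pi0; move: (@pi R) => q; rewrite mulf_eq0 negb_or => /andP[_ q0].
by field; rewrite q0 an.
Qed.

(** Within one period the cosine takes both values 1 and -1, and one of them is at distance at least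
    1 from [cos be]. *)
Lemma cos_swing (be a T : R) : a != 0 ->
  exists t, [/\ T <= t, t <= T + `|a|^-1 & 1 <= `|cos (be + 2 * pi * a * t) - cos be|].
Proof.
move=> a0; case: (leP (cos be) 0) => c0.
  have [t [t1 t2 t3]] := cos_hit1 be T a0; exists t; split => //.
  by rewrite t3 ger0_norm; lra.
have [t [t1 t2 t3]] := cos_hit1 (be + pi) T a0; exists t; split => //.
move: t3; rewrite -addrA [pi + _]addrC addrA cosDpi => t3.
by rewrite ler0_norm; lra.
Qed.

End RealODE.

(** * Explicit orbits and their escape for s > 0 *)

Section Flow.
Variables (R : realType) (n : nat).
Local Notation C := R[i].
Local Notation d := n.+1.
Variables (w : 'I_d -> R) (k : nat -> 'I_d -> int) (M : nat -> nat).
Local Notation e := (small_div w k).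
Hypothesis M2 : forall j, (j.+1 ^ 2 <= M j)%N.
Hypothesis kM : forall j i, (`|k j i| <= M j)%N.
Hypothesis k0 : forall j, k j ord_max = 0.
Hypothesis e_small : forall j, `|e j| <= expR (- ((j.+1 ^ 2)%N%:R * (M j)%:R)).
Local Notation MR := (fun j => (M j)%:R : R).
Local Notation sx := (inr ord_max : 'I_d + 'I_d)%type.
Local Notation mu := (mexp R M).
Local Notation H := (Hr w k M).
Local Notation A := (amp M).
Implicit Types (p : ptT R d).

(** The derivative of [amp M j] in s. *)
Definition damp (j : nat) (s : R) : R :=
  (mu j * s ^+ j.+2 + j.+2%:R * s ^+ j.+1) * expR (mu j * s).

Lemma Hr_pder p x : pder H p x = complex.Re (Hgrad w k M (cplx p) x).
Proof. by apply: (@quad_diff_pder _ _ (Hc w k M)) => //; exact: Hc_quad_diff. Qed.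

Lemma Hr_pder_ang p i : pder H p (inl i) =
  rsum (fun j => - (2 * pi * (k j i)%:~R * e j * A j (p sx) * sin (phase k (ang p) j))).
Proof.
rewrite Hr_pder /Hgrad add0r /trig_grad.
have h : tadm k M mu (fun j => freq k 1 mu j (inl i) * cH w k j) (cplx p).
  apply: tadm_mul; first exact: cH_adm.
  exact: freq_moderate.
have [_ ->] := trig_real M2 kM (@mexp_ok R M) nu_ok_S2 h.
congr rsum; apply/funext => j /=.
by rewrite /rterm /amp /freq /cH /=; field.
Qed.

Lemma Hr_pder_act p i : pder H p (inr i) = w i + (if i == ord_max then
  rsum (fun j => e j * damp j (p sx) * cos (phase k (ang p) j)) else 0).
Proof.
rewrite Hr_pder /Hgrad ReD /trig_grad /=; congr (_ + _); case: eqP => // _.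
have h1 : tadm k M mu (fun j => ((mu j)%:C)%C * cH w k j) (cplx p).
  apply: tadm_mul; [exact: cH_adm | exact: mexp_moderate].
have h2 : tadm k M mu (fun j => j.+2%:R * cH w k j) (cplx p).
  apply: tadm_mul; [exact: cH_adm | exact: nu_moderate].
have [g1 e1] := trig_real M2 kM (@mexp_ok R M) nu_ok_S2 h1.
have [g2 e2] := trig_real M2 kM (@mexp_ok R M) nu_ok_S1 h2.
rewrite ReD e1 e2 /= -rsumD //; congr rsum; apply/funext => j.
have -> : (j.+2%:R : C) = ((j.+2%:R : R)%:C)%C by rewrite (rmorph_nat (real_complex R)).
by rewrite /rterm /damp /cH /=; field.
Qed.

Lemma M_le_exp j : (M j)%:R <= expR (M j)%:R :> R.
Proof. by apply: le_trans (expR_ge1Dx _); rewrite lerDr. Qed.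

Lemma nat_le_2M j : (j.+2 <= 2 * M j)%N.
Proof. by have := M_gt M2 j; have := M2 j; case: j => [|j]; lia. Qed.

Lemma amp_le j s : `|A j s| <= expR (2 * `|s| * (M j)%:R + `|s| * mu j).
Proof.
apply: le_trans (amp_norm _ _ _) _.
rewrite expRD [`|s| * mu j]mulrC ler_wpM2r ?expR_ge0 //.
apply: le_trans (expr_le_expR _ (normr_ge0 s)) _; rewrite ler_expR.
rewrite [2 * _]mulrC -mulrA ler_wpM2l //.
by rewrite -natrM ler_nat nat_le_2M.
Qed.

Lemma damp_le j s : `|damp j s| <= 3 * expR ((2 * `|s| + 4) * (M j)%:R + `|s| * mu j).
Proof.
set x := `|s|; have x0 : 0 <= x by exact: normr_ge0.
pose E := expR (2 * x * (M j)%:R + 2 * (M j)%:R).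
have m0 : 0 <= mu j by rewrite /mexp.
have pw i : (i <= j.+2)%N -> x ^+ i <= E.
  move=> ij; apply: (@le_trans _ _ ((1 + x) ^+ j.+2)).
    apply: (@le_trans _ _ ((1 + x) ^+ i)).
      by rewrite lerXn2r ?nnegrE ?addr_ge0 // lerDr.
    by rewrite ler_weXn2l // lerDl.
  have h : 0 <= 1 + x by rewrite addr_ge0.
  apply: le_trans (expr_le_expR _ h) _; rewrite ler_expR.
  have : (j.+2%:R : R) <= 2 * (M j)%:R by rewrite -natrM ler_nat nat_le_2M.
  by nra.
have mm : mu j <= expR (2 * (M j)%:R).
  rewrite /mexp natrM [2 * _]mulr_natl mulr2n expRD.
  apply: ler_pM => //; last exact: M_le_exp.
  by apply: le_trans (M_le_exp j); rewrite ler_nat M_gt.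
have jm : j.+2%:R <= 2 * expR (2 * (M j)%:R) :> R.
  apply: (@le_trans _ _ (2 * (M j)%:R)); first by rewrite -natrM ler_nat nat_le_2M.
  rewrite ler_wpM2l //; apply: le_trans (M_le_exp j) _.
  by rewrite ler_expR ler_peMl // ler1n.
have E0 : 0 <= E by exact: expR_ge0.
rewrite /damp normrM (ger0_norm (expR_ge0 _)).
have -> : 3 * expR ((2 * x + 4) * (M j)%:R + x * mu j) =
    (3 * expR (2 * (M j)%:R) * E) * expR (mu j * x).
  by rewrite /E -!mulrA -!expRD; congr (_ * expR _); ring.
apply: ler_pM; rewrite ?expR_ge0 //; last by rewrite ler_expR ler_wpM2l // ler_norm.
apply: le_trans (ler_normD _ _) _.
have -> : 3 * expR (2 * (M j)%:R) * E = expR (2 * (M j)%:R) * E + 2 * expR (2 * (M j)%:R) * E by ring.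
by apply: lerD; rewrite normrM normrX -/x ger0_norm //; apply: ler_pM; rewrite ?exprn_ge0 ?pw.
Qed.

(** Supplies the hypothesis of [wave]: amplitudes of size exp(S m_j) become summable after
    multiplication by the speed 2 pi e_j. *)
Lemma weighted_geo (b : nat -> R) (c K S : R) :
  (forall j, `|b j| <= c * expR (K * (M j)%:R + S * mu j)) ->
  geo (fun j => b j * (2 * pi * e j)).
Proof.
move=> hb; have [D hD] := small_geo M2 e_small S K.
have c0 : 0 <= c.
  by have := le_trans (normr_ge0 _) (hb 0%N); rewrite pmulr_lge0 // expR_gt0.
exists (c * (2 * pi) * D) => j; rewrite !normrM (ger0_norm (ler0n R 2)) (ger0_norm (pi_ge0 R)).
apply: le_trans (ler_wpM2r _ (hb j)) _; first by rewrite !mulr_ge0 ?pi_ge0.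
have -> : c * expR (K * (M j)%:R + S * mu j) * (2 * pi * `|e j|) =
  c * (2 * pi) * (`|e j| * expR (K * (M j)%:R + S * mu j)) by ring.
by rewrite -[_ * D * _]mulrA ler_wpM2l ?mulr_ge0 ?pi_ge0 //; exact: hD.
Qed.

Lemma small_div_le1 j : `|e j| <= 1.
Proof.
apply: le_trans (e_small j) _; rewrite -expR0 ler_expR oppr_le0 mulr_ge0 //.
Qed.

Lemma tau_bounded : exists T, forall j, `|2 * pi * e j| <= T.
Proof.
exists (2 * pi) => j; rewrite normrM ger0_norm ?mulr_ge0 ?pi_ge0 //.
by rewrite ler_piMr ?mulr_ge0 ?pi_ge0 // small_div_le1.
Qed.

Section Orbit.
Variable p : ptT R d.
Local Notation s := (p sx).
Local Notation ph := (phase k (ang p)).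
Local Notation tau := (fun j => 2 * pi * e j).

Lemma act_geo i : geo (fun j => - ((k j i)%:~R * A j s) * (2 * pi * e j)).
Proof.
apply: (@weighted_geo _ 1 (2 * `|s| + 1) `|s|) => j.
rewrite mul1r normrN normrM mulrDl mul1r [_ + (M j)%:R]addrC -addrA expRD.
apply: ler_pM => //; last exact: amp_le.
by apply: le_trans (M_le_exp j); exact: norm_k.
Qed.

Lemma ang_geo : geo (fun j => damp j s / (2 * pi) * (2 * pi * e j)).
Proof.
apply: (@weighted_geo _ (3 / (2 * pi)) (2 * `|s| + 4) `|s|) => j.
rewrite normrM normfV (ger0_norm (_ : 0 <= 2 * pi)) ?mulr_ge0 ?pi_ge0 // mulrAC.
by rewrite ler_wpM2r ?invr_ge0 ?mulr_ge0 ?pi_ge0 // damp_le.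
Qed.

Definition orbit_act i t : R :=
  p (inr i) + wave (fun j => - ((k j i)%:~R * A j s)) ph tau t.
(** The angular velocity is a cosine whereas [wave] differentiates to a sine, hence the shift by
    -pi/2; dividing by 2 pi compensates the speed 2 pi e_j. *)
Definition orbit_ang i t : R := p (inl i) + (w i * t + if i == ord_max then
  wave (fun j => damp j s / (2 * pi)) (fun j => ph j - pi / 2) tau t else 0).
Definition orb t : ptT R d := fun x =>
  match x with inl i => orbit_ang i t | inr i => orbit_act i t end.

Lemma wave0 (b be tau : nat -> R) : wave b be tau 0 = 0.
Proof.
rewrite /wave (_ : (fun j => _) = (fun=> 0)) ?rsum0 //.
by apply/funext => j; rewrite mulr0 addr0 subrr mulr0.
Qed.

Lemma orb0 : orb 0 = p.
Proof.
apply/funext => -[i|i] /=; rewrite /orbit_ang /orbit_act !wave0 ?mulr0 ?addr0 //.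
by case: ifP; rewrite !addr0.
Qed.

Lemma orbit_act_max t : orbit_act ord_max t = s.
Proof.
rewrite /orbit_act /wave (_ : (fun j => _) = (fun=> 0)) ?rsum0 ?addr0 //.
by apply/funext => j; rewrite k0 mul0r oppr0 mul0r.
Qed.

Lemma phase_flow (th : 'I_d -> R) t j :
  (forall i, i != ord_max -> th i = p (inl i) + w i * t) ->
  phase k th j = ph j + 2 * pi * e j * t.
Proof.
move=> hth; rewrite /phase /small_div -!mulrA -mulrDr -mulrDr; congr (_ * (_ * _)).
rewrite mulr_suml -big_split; apply: eq_bigr => i _ /=.
have [->|ni] := eqVneq i ord_max; first by rewrite k0 !mul0r mulr0 mul0r addr0.
by rewrite hth // /ang; ring.
Qed.

Lemma orbit_act_derive i (t : R) (q : ptT R d) : q sx = s ->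
  (forall j, phase k (ang q) j = ph j + 2 * pi * e j * t) ->
  is_derive t 1 (orbit_act i) (- pder H q (inl i)).
Proof.
move=> qs qp; rewrite Hr_pder_ang.
have g := act_geo i; have hw := wave_derive ph g tau_bounded t.
have -> : - rsum (fun j => - (2 * pi * (k j i)%:~R * e j * A j (q sx) * sin (phase k (ang q) j))) =
  0 + rsum (fun j => - (- ((k j i)%:~R * A j s) * (2 * pi * e j) * sin (ph j + 2 * pi * e j * t))).
  rewrite add0r -mulN1r -rsumZ; last first.
    have [D hD] := wave_speed_geo ph g t; exists D => j; apply: le_trans (hD j).
    by rewrite qs qp -normrN le_eqVlt; apply/orP; left; apply/eqP; congr `|_|; ring.
  by congr rsum; apply/funext => j; rewrite qs qp; ring.
exact: is_deriveD.
Qed.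

Lemma orbit_ang_derive i (t : R) (q : ptT R d) : q sx = s ->
  (forall j, phase k (ang q) j = ph j + 2 * pi * e j * t) ->
  is_derive t 1 (orbit_ang i) (pder H q (inr i)).
Proof.
move=> qs qp; rewrite Hr_pder_act.
have hl : is_derive t 1 (fun t : R => w i * t) (w i).
  have h := is_deriveZ (w i) (is_derive_id t (1 : R)).
  by rewrite /GRing.scale /= mulr1 in h; exact: h.
rewrite /orbit_ang; have [->|ni] := eqVneq i ord_max; last first.
  have hc := is_deriveD (is_derive_cst (p (inl i)) t 1) (is_deriveD hl (is_derive_cst (0 : R) t 1)).
  by rewrite add0r in hc; exact: hc.
have hw := wave_derive (fun j => ph j - pi / 2) ang_geo tau_bounded t.
have hl' : is_derive t 1 (fun t : R => w ord_max * t) (w ord_max).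
  have h := is_deriveZ (w ord_max) (is_derive_id t (1 : R)).
  by rewrite /GRing.scale /= mulr1 in h; exact: h.
have hc := is_deriveD (is_derive_cst (p (inl ord_max)) t 1) (is_deriveD hl' hw).
rewrite add0r in hc; rewrite (_ : rsum _ = rsum (fun j => - (damp j s / (2 * pi) *
  (2 * pi * e j) * sin (ph j - pi / 2 + 2 * pi * e j * t)))); first exact: hc.
congr rsum; apply/funext => j.
rewrite qs qp addrAC sinBpihalf.
have p0 : pi != 0 :> R by rewrite gt_eqF // pi_gt0.
by move: (ph j + _) => x; move: (@pi R) p0 => y y0; field; rewrite y0.
Qed.

Lemma orb_sol : ham_sol_fwd H orb.
Proof.
move=> t t0 i.
have qs : orb t sx = s by exact: orbit_act_max.
have qp j : phase k (ang (orb t)) j = ph j + 2 * pi * e j * t.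
  apply: phase_flow => l /negPf nl; rewrite /ang /= /orbit_ang nl addr0 //.
by split; [exact: orbit_ang_derive | exact: orbit_act_derive].
Qed.

Lemma sol_act (gamma : R -> ptT R d) : gamma 0 = p -> ham_sol_fwd H gamma ->
  forall t i, 0 <= t -> gamma t (inr i) = orbit_act i t.
Proof.
move=> g0 hg.
have gs (t : R) : 0 <= t -> gamma t sx = s.
  have h0 : gamma 0 sx = cst s (0 : R) by rewrite g0.
  have h1 (r : R) : 0 <= r -> is_derive r 1 (fun t => gamma t sx) 0.
    move=> r0; have [_] := hg r r0 ord_max; rewrite Hr_pder_ang.
    have -> : (fun j => - (2 * pi * (k j ord_max)%:~R * e j * A j (gamma r sx) *
        sin (phase k (ang (gamma r)) j))) = (fun=> 0).
      by apply/funext => j; rewrite k0 mulr0 !mul0r oppr0.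
    by rewrite rsum0 oppr0.
  have h2 (r : R) : 0 <= r -> is_derive r 1 (cst s) (0 : R) by move=> _; exact: is_derive_cst.
  exact: (eq_of_derive h0 h1 h2).
have ga i (t : R) : i != ord_max -> 0 <= t -> gamma t (inl i) = p (inl i) + w i * t.
  move=> ni.
  have h0 : gamma 0 (inl i) = p (inl i) + w i * 0 by rewrite g0 mulr0 addr0.
  have h1 (r : R) : 0 <= r -> is_derive r 1 (fun t => gamma t (inl i)) (w i).
    by move=> r0; have [+ _] := hg r r0 i; rewrite Hr_pder_act (negPf ni) addr0.
  have h2 (r : R) : 0 <= r -> is_derive r 1 (fun t => p (inl i) + w i * t) (w i).
    move=> _; have h := is_deriveZ (w i) (is_derive_id r (1 : R)).
    rewrite /GRing.scale /= mulr1 in h.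
    have hc := is_deriveD (is_derive_cst (p (inl i)) r 1) h.
    by rewrite add0r in hc; exact: hc.
  exact: (eq_of_derive h0 h1 h2).
move=> t i.
have h0 : gamma 0 (inr i) = orbit_act i 0 by rewrite g0 /orbit_act wave0 addr0.
have h1 (r : R) : 0 <= r -> is_derive r 1 (fun t => gamma t (inr i)) (- pder H (gamma r) (inl i)).
  by move=> r0; have [] := hg r r0 i.
have h2 (r : R) : 0 <= r -> is_derive r 1 (orbit_act i) (- pder H (gamma r) (inl i)).
  move=> r0; apply: orbit_act_derive; first exact: gs.
  by move=> j; apply: phase_flow => l nl; exact: ga.
exact: (eq_of_derive h0 h1 h2).
Qed.

End Orbit.

Hypothesis e_ne0 : forall j, e j != 0.
Hypothesis e_dec : forall j l, (j < l)%N -> `|e l| <= `|e j| * expR (- ((l.+1 ^ 2)%N%:R * (M l)%:R)).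
Hypothesis M_mono : forall j, (M j <= M j.+1)%N.

Lemma k_ne0 j : exists i, k j i != 0.
Proof.
apply/existsP; rewrite -[X in is_true X]negbK negb_exists; apply/negP => /forallP h.
have := e_ne0 j; rewrite /small_div big1 ?eqxx // => i _.
by have := h i; rewrite negbK => /eqP ->; rewrite mulr0.
Qed.

Lemma M_homo : {homo M : j l / (j <= l)%N}.
Proof.
move=> j l /subnK <-; elim: (l - j)%N => // m IH.
by rewrite addSn; exact: leq_trans IH (M_mono _).
Qed.

(** For l < j one has m_l <= j M_j, so a factor exp(M_j s) separates A_j from all earlier modes. As
    M_j >= (j+1)^2, it outgrows their number, the factors M_l, the powers of 1 + s and, if s < 1,
    the smallness of s^(j+2). *)
Lemma amp_growth (s B : R) : 0 < s ->
  exists j, B + \sum_(l < j) 2 * (M l)%:R * A l s <= A j s.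
Proof.
move=> s0; pose S := 1 + s; pose c := 2 / s + `|B|; pose L := `|ln s|.
have c0 : 0 <= c by rewrite addr_ge0 // divr_ge0 // ltW.
have S0 : 0 <= S by rewrite addr_ge0 // ltW.
have S1 : 1 <= S by rewrite lerDl ltW.
(* Read off from the last comparison: with x = j+1 it suffices that x s >= 2 (2 + S + c + 2 L), the
   2 because only half of m s is left. *)
pose G := 2 * (2 + S + c + 2 * L) / s.
have G0 : 0 <= G.
  rewrite /G divr_ge0 ?(ltW s0) // mulr_ge0 //.
  by have L0 : 0 <= L := normr_ge0 _; lra.
have [j hG] : exists j : nat, G <= j%:R.
  by exists (Num.bound G); rewrite ltW // archi_boundP.
exists j.
pose m : R := (M j)%:R; pose x : R := j.+1%:R.
have x1 : 1 <= x by rewrite ler1n.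
have mx : x ^+ 2 <= m by rewrite -natrX ler_nat.
have a1 : 1 <= expR (j%:R * m * s) by rewrite -expR0 ler_expR !mulr_ge0 // ltW.
have low l : (l < j)%N -> 2 * (M l)%:R * A l s <= 2 * m * (S ^+ j.+1 * expR (j%:R * m * s)).
  move=> lj; have Ml : (M l)%:R <= m by rewrite ler_nat M_homo // ltnW.
  have Al0 : 0 <= A l s by rewrite /amp mulr_ge0 ?expR_ge0 // exprn_ge0 // ltW.
  have Ml2 : 2 * (M l)%:R <= 2 * m by rewrite ler_wpM2l.
  apply: (ler_pM _ Al0 Ml2); first by rewrite mulr_ge0.
  rewrite /amp; apply: ler_pM; rewrite ?exprn_ge0 ?expR_ge0 ?(ltW s0) //.
    apply: (@le_trans _ _ (S ^+ l.+2)); last by rewrite ler_weXn2l.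
    by rewrite lerXn2r ?nnegrE ?(ltW s0) // lerDr.
  rewrite ler_expR ler_wpM2r ?(ltW s0) // /mexp -natrM ler_nat leq_mul //.
  by rewrite M_homo // ltnW.
have sumle : \sum_(l < j) 2 * (M l)%:R * A l s <= j%:R * (2 * m * (S ^+ j.+1 * expR (j%:R * m * s))).
  apply: (@le_trans _ _ (\sum_(l < j) 2 * m * (S ^+ j.+1 * expR (j%:R * m * s)))).
    by apply: ler_sum => l _; exact: low.
  by rewrite sumr_const card_ord [leRHS]mulr_natl.
(* The common factor exp(j m s) is removed. Half of exp(m s) absorbs 2 m; the other half has to beat
   the rest. *)
have key : j%:R * (2 * m) * S ^+ j.+1 + `|B| <= s ^+ j.+2 * expR (m * s).
  have e1 : j%:R * S ^+ j.+1 <= expR ((1 + S) * x).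
    rewrite mulrDl mul1r expRD; apply: ler_pM; rewrite ?exprn_ge0 //.
      apply: (@le_trans _ _ x); first by rewrite ler_nat.
      by apply: le_trans (expR_ge1Dx _); rewrite lerDr.
    exact: expr_le_expR.
  have e2 : 2 * m <= 4 / s * expR (m * s / 2).
    have := expR_ge1Dx (m * s / 2) => h.
    rewrite -ler_pdivrMl ?divr_gt0 // invf_div.
    apply: le_trans h; have -> : s / 4 * (2 * m) = m * s / 2 by field.
    by rewrite lerDr.
  have e3 : 2 <= expR x.
    by apply: le_trans (expR_ge1Dx _); rewrite -[2]/(1 + 1) lerD2l.
  have b1 : j%:R * (2 * m) * S ^+ j.+1 <= 2 / s * expR (m * s / 2 + (2 + S) * x).
    have -> : j%:R * (2 * m) * S ^+ j.+1 = (2 * m) * (j%:R * S ^+ j.+1) by ring.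
    have -> : 2 / s * expR (m * s / 2 + (2 + S) * x) =
      2 / s * expR (m * s / 2) * expR x * expR ((1 + S) * x).
      by rewrite -!mulrA -!expRD; congr (_ * (_ * expR _)); ring.
    apply: ler_pM; rewrite ?mulr_ge0 ?exprn_ge0 //.
    apply: le_trans e2 _.
    have -> : 4 / s * expR (m * s / 2) = 2 / s * expR (m * s / 2) * 2 by ring.
    by rewrite ler_wpM2l // !mulr_ge0 ?expR_ge0 // invr_ge0 ltW.
  have b2 : `|B| <= `|B| * expR (m * s / 2 + (2 + S) * x).
    rewrite ler_peMr // -expR0 ler_expR addr_ge0 // ?mulr_ge0 ?addr_ge0 // ?ltW //.
  apply: le_trans (lerD b1 b2) _; rewrite -mulrDl -/c.
  apply: (@le_trans _ _ (expR c * expR (m * s / 2 + (2 + S) * x))).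
    rewrite ler_wpM2r ?expR_ge0 //; apply: le_trans (expR_ge1Dx _).
    by rewrite lerDr.
  rewrite -expRD -{2}[s]lnK ?posrE // -expRM_natl -expRD ler_expR.
  have sL : - ln s <= L by rewrite /L -normrN ler_norm.
  have L0 : 0 <= L by exact: normr_ge0.
  have -> : j.+2%:R = x + 1 by rewrite natr1.
  have gx : 2 * (2 + S + c + 2 * L) <= x * s.
    rewrite -ler_pdivrMr //; apply: le_trans hG _; by rewrite ler_nat.
  have mxs : x * (x * s) <= m * s.
    by rewrite mulrA -expr2 ler_wpM2r // ltW.
  have xg : x * (2 * (2 + S + c + 2 * L)) <= m * s.
    by apply: le_trans mxs; rewrite ler_wpM2l // (le_trans ler01).
  have cx : c <= c * x by rewrite ler_peMr.
  have Lx : L <= L * x by rewrite ler_peMr.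
  have l1 : - (x + 1) * ln s <= (x + 1) * L.
    by rewrite mulNr -mulrN ler_wpM2l // addr_ge0 // (le_trans ler01).
  by lra.
have -> : A j s = s ^+ j.+2 * expR (m * s) * expR (j%:R * m * s).
  rewrite /amp -mulrA -expRD; congr (_ * expR _).
  by rewrite /mexp natrM -natr1 -/m; ring.
apply: le_trans (lerD (ler_norm B) sumle) _.
apply: le_trans (ler_wpM2r (expR_ge0 _) key).
rewrite [leRHS]mulrDl [leRHS]addrC; apply: lerD; first by rewrite ler_peMr.
by rewrite le_eqVlt; apply/orP; left; apply/eqP; ring.
Qed.

(** The order of choices matters: the tail bound [D'] does not depend on j, so j can be chosen to
    make A_j exceed it; the component and the swing time come after j. *)
Lemma orbit_unbounded (p : ptT R d) (B T : R) : 0 < p sx ->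
  exists2 t, T <= t /\ 0 <= t & exists i, B < `|orbit_act p i t|.
Proof.
set s := p sx => s0; pose T0 := Num.max T 0.
have T00 : 0 <= T0 by rewrite le_max lexx orbT.
have pi0 : 0 <= pi :> R := pi_ge0 R.
(* Applied to the majorant exp(-(l+1)^2 M_l) in place of the divisors, which covers both parts of
   the later tail estimate. *)
have [D hD] := @small_geo R M M2 (fun l => expR (- ((l.+1 ^ 2)%N%:R * (M l)%:R)))
  (fun j => eq_ind_r (fun x => x <= _) (lexx _) (ger0_norm (expR_ge0 _))) `|s| (2 * `|s| + 1).
pose D' := 4 * pi * (T0 + 1) * D.
(* The component is known only after j, so the initial actions are bounded all together. *)
pose P := \sum_i `|p (inr i)|.
have [j hj] := amp_growth (B + 2 * D' + P + 1) s0.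
have [i ki] := k_ne0 j.
have [t [t1 t2 t3]] := cos_swing (phase k (ang p) j) T0 (e_ne0 j).
have t0 : 0 <= t by apply: le_trans t1.
exists t; first by split=> //; apply: le_trans t1; rewrite le_max lexx.
exists i; rewrite /orbit_act.
set b := fun l => - ((k l i)%:~R * A l s).
pose u l := b l * (cos (phase k (ang p) l + 2 * pi * e l * t) - cos (phase k (ang p) l)).
have gu : geo u by exact: wave_geo (act_geo p i) t.
have A0 l : 0 <= A l s by rewrite /amp mulr_ge0 ?exprn_ge0 ?expR_ge0 // ltW.
have tail l : (j.+1 <= l)%N -> `|u l| <= D' * 2^-1 ^+ l.
  move=> jl; rewrite /u normrM.
  pose ex : R := expR (- ((l.+1 ^ 2)%N%:R * (M l)%:R)).
  (* At most T0 + 1 / |e_j| has elapsed: [e_small] bounds |e_l| T0, and [e_dec] bounds |e_l| /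
     |e_j|. *)
  have et : `|e l| * t <= (T0 + 1) * ex.
    have h1 : `|e l| * t <= `|e l| * (T0 + `|e j|^-1) by rewrite ler_wpM2l.
    apply: le_trans h1 _; rewrite mulrDr mulrDl; apply: lerD.
      by rewrite mulrC ler_wpM2l //; exact: e_small.
    rewrite mul1r ler_pdivrMr ?normr_gt0 // mulrC; exact: e_dec.
  have cs : `|cos (phase k (ang p) l + 2 * pi * e l * t) - cos (phase k (ang p) l)| <=
      4 * pi * (T0 + 1) * ex.
    apply: le_trans (cos_shift_le _ _) _.
    rewrite !normrM (ger0_norm (ler0n R 2)) (ger0_norm pi0) (ger0_norm t0).
    have -> : 2 * (2 * pi * `|e l| * t) = 4 * pi * (`|e l| * t) by ring.
    by rewrite -[4 * pi * _ * _]mulrA ler_wpM2l // mulr_ge0.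
  have bl : `|b l| <= expR ((2 * `|s| + 1) * (M l)%:R + `|s| * mu l).
    rewrite /b normrN normrM mulrDl mul1r [_ + (M l)%:R]addrC -addrA expRD.
    apply: ler_pM => //; last exact: amp_le.
    by apply: le_trans (M_le_exp l); exact: norm_k.
  apply: le_trans (ler_pM (normr_ge0 _) (normr_ge0 _) bl cs) _.
  have -> : expR ((2 * `|s| + 1) * (M l)%:R + `|s| * mu l) * (4 * pi * (T0 + 1) * ex) =
    4 * pi * (T0 + 1) * (ex * expR ((2 * `|s| + 1) * (M l)%:R + `|s| * mu l)) by ring.
  have c40 : 0 <= 4 * pi * (T0 + 1).
    by apply: mulr_ge0; [exact: mulr_ge0 | exact: addr_ge0].
  rewrite /D' -[_ * D * _]mulrA; apply: (ler_wpM2l c40).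
  by have := hD l; rewrite ger0_norm ?expR_ge0.
have := rsum_tail gu tail; rewrite big_ord_recr /=.
have kj : A j s <= `|u j|.
  rewrite /u /b normrM normrN normrM (ger0_norm (A0 j)).
  have k1 : 1 <= `|(k j i)%:~R| :> R.
    by rewrite -intr_norm ler1z -gtz0_ge1 normr_gt0.
  rewrite -[A j s]mulr1 ler_pM // mulr1 ler_peMl //.
have lowsum : `|\sum_(l < j) u l| <= \sum_(l < j) 2 * (M l)%:R * A l s.
  apply: le_trans (ler_norm_sum _ _ _) _; apply: ler_sum => l _.
  rewrite /u /b normrM normrN normrM (ger0_norm (A0 l)).
  have c2 : `|cos (phase k (ang p) l + 2 * pi * e l * t) - cos (phase k (ang p) l)| <= 2.
    apply: le_trans (ler_normB _ _) _; rewrite -[2]/(1 + 1).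
    by rewrite lerD // cos_max.
  have := norm_k R kM l i => kl.
  rewrite mulrAC; apply: ler_wpM2r => //.
  by have := ler_pM (normr_ge0 _) (normr_ge0 _) kl c2; rewrite [(M l)%:R * 2]mulrC.
have pP : `|p (inr i)| <= P by rewrite /P (bigD1 i) //= lerDl sumr_ge0.
rewrite -/(wave _ _ _ t) => hr.
have -> : wave b (phase k (ang p)) (fun l => 2 * pi * e l) t = rsum u by [].
set r := rsum u in hr *; set X := \sum_(l < j) u l in hr lowsum *.
have h1 : `|u j| <= `|r| + `|X| + 2 * D'.
  have -> : u j = r - X - (r - (X + u j)) by ring.
  by apply: le_trans (ler_normB _ _) _; apply: lerD => //; exact: ler_normB.
have h2 : `|r| <= `|p (inr i) + r| + `|p (inr i)|.
  have -> : r = (p (inr i) + r) - p (inr i) by ring.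
  by rewrite [X in _ <= `|X| + _](_ : _ = p (inr i) + r); [exact: ler_normB | ring].
by lra.
Qed.

End Flow.

(** * Birkhoff normal form *)

Section BirkhoffNormalForm.
Variables (R : realType) (n : nat).
Local Notation C := R[i].
Local Notation d := n.+1.
Variables (w : 'I_d -> R) (k : nat -> 'I_d -> int) (M : nat -> nat).
Local Notation e := (small_div w k).
Hypothesis M2 : forall j, (j.+1 ^ 2 <= M j)%N.
Hypothesis kM : forall j i, (`|k j i| <= M j)%N.
Hypothesis k0 : forall j, k j ord_max = 0.
Hypothesis e_small : forall j, `|e j| <= expR (- ((j.+1 ^ 2)%N%:R * (M j)%:R)).
Local Notation sx := (inr ord_max : 'I_d + 'I_d)%type.
Local Notation mu := (mexp R M).
Local Notation H := (Hr w k M).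
Local Notation z0 := (fun=> 0 : R).
Local Notation nu0 := (fun=> 0%N : nat).
Local Notation Tr0 := (trig k nu0 z0).

Lemma nu_ok_0 : nu_ok nu0. Proof. by []. Qed.

Lemma quad_diff_joinpt (F : ptT C d -> C) (th r : 'I_d -> C) G :
  quad_diff F (joinpt th r) G ->
  quad_diff (fun th => F (joinpt th r)) th (fun i => G (inl i)).
Proof.
move=> [B [r0 [B0 r00 h]]]; exists B, r0; split => // t v t0 tr hv.
have := h t (joinpt v (fun=> 0)) t0 tr.
have -> : (fun x => joinpt th r x + joinpt v (fun=> 0) x) = joinpt (fun x => th x + v x) r.
  by apply/funext => -[i|i] //=; rewrite addr0.
rewrite big_sumType /= [X in _ - (_ + X)]big1 ?addr0 => [|i _]; last by rewrite mulr0.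
by apply=> -[i|i] /=; rewrite ?cabs0.
Qed.

Lemma cplx_joinpt (th r : 'I_d -> R) : cplx (joinpt th r) = joinpt (cplx th) (cplx r).
Proof. by apply/funext => -[i|i]. Qed.

(** With zero power and zero rate the actions are immaterial and set to 0; trigonometric polynomials
    thereby inherit the calculus of [trig]. *)
Definition fin_trig (c : nat -> C) (th : 'I_d -> R) : R :=
  complex.Re (Tr0 c (joinpt (cplx th) (cplx z0))).

Section FiniteTrig.
Variables (c : nat -> C) (N : nat).
Hypothesis c_fin : forall j, (N <= j)%N -> c j = 0.

Lemma fin_adm z : tadm k M z0 c z. Proof. exact: tadm_fin c_fin. Qed.

Lemma fin_trig_quad_diff th :
  quad_diff (fun th => Tr0 c (joinpt th (cplx z0))) th
    (fun i => Tr0 (fun j => freq k 1 z0 j (inl i) * c j) (joinpt th (cplx z0))).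
Proof.
have h := trig_quad_diff M2 kM (@zero_ok R M) nu_ok_0 (fin_adm (joinpt th (cplx z0))).
exact: (quad_diff_joinpt h).
Qed.

Lemma fin_trig_analytic : real_analytic_on setT (fin_trig c).
Proof.
move=> p _; exists 1 => //.
exists (fun th => Tr0 c (joinpt th (cplx z0))); split.
  by apply: quad_diff_holo => z _; eexists; exact: fin_trig_quad_diff.
move=> x _ _; rewrite /fin_trig -cplx_joinpt.
exact: (trig_cplx M2 kM (@zero_ok R M) nu_ok_0 (fin_adm _)).
Qed.

Lemma fin_trig_pder th i : pder (fin_trig c) th i =
  fin_trig (fun j => freq k 1 z0 j (inl i) * c j) th.
Proof.
exact: (@quad_diff_pder _ _ (fun th => Tr0 c (joinpt th (cplx z0))) _ _ _ _
  (fun=> erefl) (fin_trig_quad_diff _)).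
Qed.

Lemma fin_trig_periodic th (q : 'I_d -> int) :
  fin_trig c (fun i => th i + (q i)%:~R) = fin_trig c th.
Proof.
rewrite /fin_trig -!cplx_joinpt.
have -> : joinpt (fun i => th i + (q i)%:~R) z0 = transl (joinpt th z0) q.
  by apply/funext => -[i|i].
by rewrite cplx_transl trig_transl.
Qed.

Lemma fin_trig_sum th :
  geo (fun j => rterm 0 0 (c j) (phase k th j) 0) /\
  fin_trig c th = rsum (fun j => rterm 0 0 (c j) (phase k th j) 0).
Proof.
rewrite /fin_trig -cplx_joinpt.
by have [g ->] := trig_real M2 kM (@zero_ok R M) nu_ok_0 (fin_adm (cplx (joinpt th z0))).
Qed.

End FiniteTrig.

Lemma fin_trig_linear (J : Type) (r : seq J) (a : J -> R) (c : J -> nat -> C) N th :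
  (forall i j, (N <= j)%N -> c i j = 0) ->
  \sum_(i <- r) a i * fin_trig (c i) th =
  fin_trig (fun j => \sum_(i <- r) ((a i)%:C)%C * c i j) th.
Proof.
move=> cN; set z := joinpt (cplx th) (cplx z0).
have [_ h] := trig_sum M2 kM r a (@zero_ok R M) nu_ok_0 (fun i => fin_adm (cN i) z).
rewrite /fin_trig -/z -h Re_sum; apply: eq_bigr => i _.
by rewrite ReZ.
Qed.

(* Coefficients of the Taylor expansion of s^(j+2) exp(mu_j s) at 0. *)
Definition taylor_coef (N j : nat) : R :=
  if (j.+2 <= N)%N then mu j ^+ (N - j.+2) / (N - j.+2)`!%:R else 0.

(** The truncated subtraction empties the inner sum when j+2 > m: such modes contribute nothing up
    to order m, so each coefficient in theta is a finite sum. *)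
Lemma taylor_sum (m j : nat) (s : R) :
  \sum_(N < m.+1) s ^+ N * taylor_coef N j =
  s ^+ j.+2 * \sum_(l < m.+1 - j.+2) (mu j * s) ^+ l / l`!%:R.
Proof.
rewrite -(big_mkord xpredT (fun N => s ^+ N * taylor_coef N j)).
rewrite -(big_mkord xpredT (fun l => (mu j * s) ^+ l / l`!%:R)).
have low a : (a <= j.+2)%N -> \sum_(0 <= N < a) s ^+ N * taylor_coef N j = 0.
  move=> aj; rewrite big_nat_cond big1 // => N /andP[/andP[_ Na] _].
  by rewrite /taylor_coef leqNgt (leq_trans Na aj) mulr0.
case: (leqP j.+2 m.+1) => jm; last first.
  by rewrite low 1?ltnW // (eqP (_ : m.+1 - j.+2 == 0)%N) ?subn_eq0 1?ltnW // big_geq ?mulr0.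
rewrite (big_cat_nat _ jm) //= low // add0r -{1}[j.+2]add0n big_addn mulr_sumr.
apply: eq_bigr => l _; rewrite /taylor_coef leq_addl addnK exprD exprMn.
ring.
Qed.

(** f depends on the actions through the last one only, so other multi-indices carry nothing. *)
Definition bnf_coef (al : mindex d) (j : nat) : C :=
  if [forall i, (i != ord_max) ==> (al i == 0%N)]
  then ((taylor_coef (al ord_max) j)%:C)%C * cF 1 j else 0.
Definition bnf (al : mindex d) : ('I_d -> R) -> R := fin_trig (bnf_coef al).

Lemma taylor_coef_fin N j : (N <= j)%N -> taylor_coef N j = 0.
Proof. by move=> Nj; rewrite /taylor_coef leqNgt ltnS (leq_trans Nj). Qed.

Lemma bnf_coef_fin (al : mindex d) j : (al ord_max <= j)%N -> bnf_coef al j = 0.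
Proof. by move=> h; rewrite /bnf_coef taylor_coef_fin // mul0r; case: ifP. Qed.

Definition trunc_coef (m : nat) (s : R) (j : nat) : C :=
  ((\sum_(N < m.+1) s ^+ N * taylor_coef N j)%:C)%C * cF 1 j.

Lemma trunc_coef_fin m s j : (m <= j)%N -> trunc_coef m s j = 0.
Proof.
move=> mj; rewrite /trunc_coef big1 ?mul0r // => N _.
by rewrite taylor_coef_fin ?mulr0 // (leq_trans _ mj) // -ltnS.
Qed.

Lemma bnf_trunc m th (r : 'I_d -> R) :
  trunc_series bnf m th r = fin_trig (trunc_coef m (r ord_max)) th.
Proof.
rewrite /trunc_series.
pose supp (al : {ffun 'I_d -> 'I_m.+1}) := [forall i, (i != ord_max) ==> (al i == 0%N :> nat)].
rewrite (bigID supp) /= [X in _ + X]big1 ?addr0; last first.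
  move=> al /andP[_ ns]; rewrite /bnf (_ : bnf_coef _ = fun=> 0).
    by rewrite /fin_trig trig0 mul0r.
  apply/funext => j; rewrite /bnf_coef; case: ifP => // /forallP h.
  case/negP: ns; apply/forallP => i; have := h i; by rewrite ffunE.
(* The multi-index with N in the last place reindexes the surviving terms by degree. *)
pose h (N : 'I_m.+1) := [ffun i : 'I_d => if i == ord_max then N else ord0].
rewrite (reindex_onto h (fun al : {ffun 'I_d -> 'I_m.+1} => al ord_max)) /=; last first.
  move=> al /andP[_ /forallP ha]; apply/ffunP => i; rewrite ffunE.
  have [->//|ni] := eqVneq i ord_max.
  by apply: val_inj; have := ha i; rewrite ni /= => /eqP ->.
rewrite (eq_bigl xpredT); last first.
  move=> N; rewrite ffunE eqxx eqxx andbT; apply/andP; split.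
    rewrite (bigD1 ord_max) //= ffunE eqxx big1 ?addn0 -1?ltnS //.
    by move=> i /negPf ni; rewrite ffunE ni.
  by apply/forallP => i; apply/implyP => /negPf ni; rewrite ffunE ni.
rewrite (eq_bigr (fun N : 'I_m.+1 => r ord_max ^+ N *
    fin_trig (fun j => ((taylor_coef N j)%:C)%C * cF 1 j) th)); last first.
  move=> N _; rewrite (bigD1 ord_max) //= ffunE eqxx [X in _ * (_ * X)]big1 ?mulr1; last first.
    by move=> i /negPf ni; rewrite ffunE ni expr0.
  rewrite mulrC /bnf (_ : bnf_coef _ = (fun j => ((taylor_coef N j)%:C)%C * cF 1 j)) //.
  apply/funext => j; rewrite /bnf_coef !ffunE eqxx ifT //.
  by apply/forallP => i; apply/implyP => /negPf ni; rewrite !ffunE ni.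
rewrite (@fin_trig_linear _ _ (fun N : 'I_m.+1 => r ord_max ^+ N)
  (fun N j => ((taylor_coef N j)%:C)%C * cF 1 j) m); last first.
  move=> N j mj; rewrite taylor_coef_fin ?mul0r //.
  by rewrite (leq_trans _ mj) // -ltnS.
congr fin_trig; apply/funext => j.
rewrite /trunc_coef (raddf_sum (real_complex R)) mulr_suml; apply: eq_bigr => N _.
by rewrite mulrA -(rmorphM (real_complex R)).
Qed.

(** The cohomological operator acts in theta only and commutes with truncation in s; the truncated f
    solves the equation with each A_j replaced by its Taylor polynomial. *)
Lemma bnf_cohomology m th s :
  geo (fun j => - (e j * (\sum_(N < m.+1) s ^+ N * taylor_coef N j) * cos (phase k th j))) /\
  \sum_i w i * pder (fin_trig (trunc_coef m s)) th i =
  rsum (fun j => - (e j * (\sum_(N < m.+1) s ^+ N * taylor_coef N j) * cos (phase k th j))).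
Proof.
under eq_bigr do rewrite (fin_trig_pder (@trunc_coef_fin m s)).
have cN (i : 'I_d) j : (m <= j)%N -> freq k 1 z0 j (inl i) * trunc_coef m s j = 0.
  by move=> mj; rewrite trunc_coef_fin ?mulr0.
rewrite (fin_trig_linear _ _ _ cN).
have cS j : (m <= j)%N -> \sum_(i <- index_enum 'I_d)
    ((w i)%:C)%C * (freq k 1 z0 j (inl i) * trunc_coef m s j) = 0.
  by move=> mj; rewrite big1 // => i _; rewrite cN ?mulr0.
have [g ->] := fin_trig_sum cS th.
have E j : rterm 0 0 (\sum_(i <- index_enum 'I_d)
    ((w i)%:C)%C * (freq k 1 z0 j (inl i) * trunc_coef m s j)) (phase k th j) 0 =
  - (e j * (\sum_(N < m.+1) s ^+ N * taylor_coef N j) * cos (phase k th j)).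
  rewrite /trunc_coef; move: (\sum_(N < m.+1) _) => t.
  have -> : \sum_(i <- index_enum 'I_d)
      ((w i)%:C)%C * (freq k 1 z0 j (inl i) * (t%:C%C * cF 1 j)) = ((- (e j * t / 2))%:C)%C.
    rewrite /small_div mulr_suml mulr_suml -sumrN (raddf_sum (real_complex R)).
    apply: eq_bigr => i _; have pi0 : pi != 0 :> R by rewrite gt_eqF // pi_gt0.
    rewrite /freq /cF; move: (@pi R) pi0 => q q0.
    by apply: ceqP => /=; [field | ring].
  by rewrite /rterm /= mulr0 expR0 expr0; field.
by split; [|congr rsum; apply/funext => j];
  [have -> : (fun j => - (e j * (\sum_(N < m.+1) s ^+ N * taylor_coef N j) * cos (phase k th j))) = _
     := esym (funext E)|].
Qed.

(** The power of |s| must be the same for all j, so that summation keeps the order m+1. The price is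
    m+1 exponentials for the power of m_j and one for the remainder of exp, which e_j can afford. If
    j+2 > m the polynomial is empty and s^(j+2) alone is small enough. *)
Lemma taylor_remainder m j (s : R) : `|s| <= 1 ->
  `|amp M j s - \sum_(N < m.+1) s ^+ N * taylor_coef N j| <=
  `|s| ^+ m.+1 * expR ((m%:R + 2) * mu j).
Proof.
move=> s1; rewrite taylor_sum /amp -mulrBr normrM normrX.
set q := (m.+1 - j.+2)%N; have m0 : 0 <= mu j by rewrite /mexp.
have x1 : expR `|mu j * s| <= expR (mu j).
  by rewrite ler_expR normrM ger0_norm // ler_piMr.
have h := le_trans (expR_taylor q (mu j * s)) (ler_wpM2l (exprn_ge0 q (normr_ge0 _)) x1).
apply: le_trans (ler_wpM2l (exprn_ge0 _ (normr_ge0 s)) h) _.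
rewrite normrM exprMn (ger0_norm m0).
have x2 : mu j ^+ q <= expR ((m%:R + 1) * mu j).
  rewrite mulrC natr1 expRM_natr.
  have e1 : 1 <= expR (mu j) by rewrite -expR0 ler_expR.
  apply: (@le_trans _ _ (expR (mu j) ^+ q)); last by rewrite ler_weXn2l // /q leq_subr.
  rewrite lerXn2r ?nnegrE ?expR_ge0 //; apply: le_trans (expR_ge1Dx _).
  by rewrite lerDr.
have x3 : `|s| ^+ j.+2 * `|s| ^+ q <= `|s| ^+ m.+1.
  rewrite -exprD ler_wiXn2l // /q; lia.
have -> : `|s| ^+ j.+2 * (mu j ^+ q * `|s| ^+ q * expR (mu j)) =
  (`|s| ^+ j.+2 * `|s| ^+ q) * (mu j ^+ q * expR (mu j)) by ring.
have -> : (m%:R + 2) * mu j = (m%:R + 1) * mu j + mu j by ring.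
rewrite expRD; apply: (ler_pM _ _ x3 (ler_wpM2r (expR_ge0 _) x2)); apply: mulr_ge0;
  by [exact: exprn_ge0 | exact: expR_ge0].
Qed.

Lemma Hr_BNF : is_BNF H (pairing w).
Proof.
exists bnf; split; [|split; [|split]].
- move=> al al1 th; rewrite /bnf (_ : bnf_coef al = fun=> 0) /fin_trig ?trig0 //.
  have am : (al ord_max <= 1)%N.
    by apply: leq_trans al1; rewrite (bigD1 ord_max) //= leq_addr.
  apply/funext => j; rewrite /bnf_coef (_ : taylor_coef _ _ = 0) ?mul0r ?if_same //.
  by rewrite /taylor_coef ifF //; apply/negbTE; rewrite -ltnNge (leq_ltn_trans am).
- by move=> al; apply: fin_trig_analytic (bnf_coef_fin (al := al)).
- by move=> al th q; exact: fin_trig_periodic.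
move=> m th.
have [D hD] := small_geo M2 e_small (m%:R + 2) 0.
have D0 : 0 <= D.
  have := hD 0%N; rewrite expr0 mulr1; apply: le_trans.
  by rewrite mulr_ge0 ?expR_ge0.
exists (2 * D + 1); first by rewrite ltr_wpDl // mulr_ge0.
exists 1 => // r hr; set s := r ord_max.
have s1 : `|s| <= 1 by exact: hr.
have -> : (fun th' => trunc_series bnf m th' r) = fin_trig (trunc_coef m s).
  by apply/funext => th'; rewrite bnf_trunc.
set f := fin_trig (trunc_coef m s).
(* The substitution thus leaves the last action at s, so the perturbation keeps its value and only
   Taylor remainders survive. *)
have f0 : pder f th ord_max = 0.
  rewrite /f (fin_trig_pder (@trunc_coef_fin m s)) (_ : (fun j => _) = (fun=> 0)).
    by rewrite /fin_trig trig0.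
  apply/funext => j; rewrite /freq k0 (_ : (1 * _)%:C%C = 0) ?mul0r //.
  by rewrite !mulr0.
have [gH ->] := Hr_sum M2 kM e_small (joinpt th (fun i => r i + pder f th i)).
rewrite /= f0 addr0 -/s in gH *.
have -> : pairing w (act (joinpt th (fun i => r i + pder f th i))) =
    pairing w r + \sum_i w i * pder f th i.
  by rewrite /pairing -big_split; apply: eq_bigr => i _; rewrite /act /= mulrDr.
have [gC ->] := bnf_cohomology m th s.
rewrite addrAC [_ + rsum _]addrC addrK -rsumD //.
have B : `|rsum (fun j => - (e j * (\sum_(N < m.+1) s ^+ N * taylor_coef N j) * cos (phase k th j)) +
     e j * amp M j s * cos (phase k th j))| <= 2 * (D * `|s| ^+ m.+1).
  apply: rsum_le => j.
  have -> : - (e j * (\sum_(N < m.+1) s ^+ N * taylor_coef N j) * cos (phase k th j)) +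
     e j * amp M j s * cos (phase k th j) =
     e j * (amp M j s - \sum_(N < m.+1) s ^+ N * taylor_coef N j) * cos (phase k th j) by ring.
  rewrite normrM normrM; apply: (@le_trans _ _ (`|e j| * `|amp M j s - \sum_(N < m.+1) s ^+ N * taylor_coef N j|)).
    by rewrite ler_piMr ?mulr_ge0 // cos_max.
  apply: le_trans (ler_wpM2l (normr_ge0 _) (taylor_remainder m j s1)) _.
  have := hD j; rewrite mul0r add0r => hDj.
  rewrite [`|s| ^+ _ * _]mulrC mulrA [D * _ * _]mulrAC; apply: ler_wpM2r hDj.
  exact: exprn_ge0.
apply: le_trans B _.
have le : `|s| ^+ m.+1 <= (\sum_(i < d) `|r i|) ^+ m.+1.
  rewrite lerXn2r ?nnegrE ?sumr_ge0 //.
  by rewrite (bigD1 ord_max) //= lerDl sumr_ge0.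
have sm0 : 0 <= `|s| ^+ m.+1 by rewrite exprn_ge0.
by move: le sm0; set a := `|s| ^+ m.+1; set b := (\sum_(_ < _) _) ^+ _; nra.
Qed.

End BirkhoffNormalForm.

(** * Extending frequency vectors by a zero coordinate *)

Section Subsequence.
Variables (R : realType) (n : nat) (w : 'I_n.+1 -> R) (kbar : nat -> 'I_n -> int).

Definition extend_freq (q : 'I_n -> int) (i : 'I_n.+1) : int :=
  if insub (i : nat) is Some i' then q i' else 0.

Lemma extend_freq_max q : extend_freq q ord_max = 0.
Proof. by rewrite /extend_freq insubF //= ltnn. Qed.

Lemma extend_freq_sum (q : 'I_n -> int) (le : (n <= n.+1)%N) :
  \sum_(i < n.+1) w i * (extend_freq q i)%:~R = \sum_(i < n) w (widen_ord le i) * (q i)%:~R.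
Proof.
rewrite big_ord_recr /= extend_freq_max mulr0 addr0; apply: eq_bigr => i _.
rewrite /extend_freq /= valK; congr (w _ * _); exact: val_inj.
Qed.

Lemma extend_freq_le (q : 'I_n -> int) i :
  (`|extend_freq q i| <= \max_(i < n) `|q i|%N)%N.
Proof.
rewrite /extend_freq; case: insubP => [i' _ _|_] //.
exact: (leq_bigmax (F := fun i => `|q i|%N) i').
Qed.

End Subsequence.

Theorem theoremE (R : realType) (d : nat) (omega : 'I_d -> R)
  (kbar : nat -> 'I_d.-1 -> int) :
  (3 <= d)%N ->
  (* omega is non-resonant *)
  (forall k : 'I_d -> int, \sum_(i < d) omega i * (k i)%:~R = 0 ->
     forall i, k i = 0) ->
  (* ln |<omega~, kbar_j>| / ||kbar_j|| -> -oo, omega~ = first d-1 coordinates *)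
  ((fun j : nat =>
      ln `|\sum_(i < d.-1) omega (widen_ord (leq_pred d) i) * (kbar j i)%:~R|
      / ((\max_(i < d.-1) `|kbar j i|%N)%N)%:R) @ \oo --> -oo) ->
  exists H : ptT R d -> R,
    real_entire_ham H /\ ham_form omega H /\
    (* (i) *)
    (exists Psi Phi : ptT R d -> ptT R d,
       analytic_sympl_diffeo_Mneg Psi Phi /\
       forall p, Mneg R d p -> H (Psi p) = pairing omega (act p)) /\
    (* (ii) *)
    (forall p, Mpos R d p ->
       (exists gamma : R -> ptT R d, gamma 0 = p /\ ham_sol_fwd H gamma) /\
       (forall gamma : R -> ptT R d, gamma 0 = p -> ham_sol_fwd H gamma ->
          forall (B T : R), exists2 t : R, T <= t &
            exists i : 'I_d, B < `|gamma t (inr i)|)) /\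
    (* Birkhoff normal form *)
    is_BNF H (pairing omega).
Proof.
case: d omega kbar => [|n] // w kbar _ _ hcv.
have [ix [M [ep0 KM hM e0 estep]]] := @select_subsequence R
  (fun j => (\max_(i < n) `|kbar j i|%N)%N)
  (fun j => `|\sum_(i < n) w (widen_ord (leq_pred n.+1) i) * (kbar j i)%:~R|) hcv.
pose k j := extend_freq (kbar (ix j)).
have eE j : `|small_div w k j| =
    `|\sum_(i < n) w (widen_ord (leq_pred n.+1) i) * (kbar (ix j) i)%:~R|.
  by rewrite /small_div /k (extend_freq_sum w (kbar (ix j)) (leq_pred n.+1)).
have M2 j : (j.+1 ^ 2 <= M j)%N by have [] := hM j.
have M_mono j : (M j <= M j.+1)%N by have [] := hM j.
have kM j i : (`|k j i| <= M j)%N by exact: leq_trans (extend_freq_le _ _) (KM j).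
have k0 j : k j ord_max = 0 by exact: extend_freq_max.
have e_ne0 j : small_div w k j != 0 by rewrite -normr_gt0 eE; exact: ep0.
have step j : `|small_div w k j.+1| <=
    `|small_div w k j| * expR (- ((j.+2 ^ 2)%N%:R * (M j.+1)%:R)).
  by rewrite !eE; exact: estep.
have exp1 j : expR (- ((j.+1 ^ 2)%N%:R * (M j)%:R)) <= 1 :> R.
  by rewrite -expR0 ler_expR oppr_le0 mulr_ge0.
have e_small j : `|small_div w k j| <= expR (- ((j.+1 ^ 2)%N%:R * (M j)%:R)).
  (* At j = 0 the square is 1 and [e0] is the claim; later on the factor |e_j| <= 1 is dropped. *)
  elim: j => [|j IH]; first by rewrite eE exp1n mul1r.
  apply: le_trans (step j) _; rewrite ler_piMl ?expR_ge0 //.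
  exact: le_trans IH (exp1 j).
have e_dec j l : (j < l)%N ->
    `|small_div w k l| <= `|small_div w k j| * expR (- ((l.+1 ^ 2)%N%:R * (M l)%:R)).
  case: l => // l; rewrite ltnS => jl; apply: le_trans (step l) _.
  rewrite ler_wpM2r ?expR_ge0 //.
  (* The last step has supplied the exponential; the earlier ones only use that the divisors
     decrease. *)
  rewrite -(subnK jl); elim: (l - j)%N => // m IH; rewrite addSn.
  apply: le_trans (step _) (le_trans _ IH).
  by rewrite ler_piMr.
exists (Hr w k M); split; first exact: Hr_entire M2 kM e_small.
split; first exact: Hr_form M2 kM e_small.
split.
  exists (Psi k M 1), (Psi k M (-1)); split; first exact: Psi_diffeo M2 kM k0.
  by move=> p hp; exact: Hr_Psi.
split; last exact: Hr_BNF.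
move=> p hp; split; first by exists (orb w k M p); split; [exact: orb0 | exact: orb_sol].
move=> gamma g0 hg B T.
have p0 : 0 < p (inr ord_max) by exact: hp.
have [t [Tt t0] [i hi]] := orbit_unbounded M2 kM e_small e_ne0 e_dec M_mono B T p0.
exists t => //; exists i.
by rewrite (sol_act M2 kM k0 e_small g0 hg).
Qed.
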